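(* Let $\Gamma$ be a tropical curve of genus $g$ and let $D$ be a special divisor on $\Gamma$. Then $$\mathrm{rk}|D| \leq \frac{\deg D}{2}.$$ Furthermore, suppose $\Gamma$ is hyperelliptic, and let $|E|$ be the $g^1_2$ on $\Gamma$, where $E$ is a divisor with $\deg E = 2$ and $\mathrm{rk}|E| = 1$. Then equality $\mathrm{rk}|D| = \frac{\deg D}{2}$ holds if and only if $D$ is a multiple of the $g^1_2$, i.e. if and only if $D \sim rE$ (equivalently $|D| = |rE|$) for some integer $r \geq 0$.
   Context: A graph is a finite connected multigraph; loops and multiple edges are allowed. A tropical curve is a pair $(\Gamma,l)$ consisting of a graph $\Gamma$ with vertex set $V(\Gamma)$ and edge set $E(\Gamma)$ and a length function $l: E(\Gamma)\to \mathbb{R}_{>0}\cup\{\infty\}$ (a metric graph with possibly unbounded ends), regarded as a topological space by identifying each edge of finite length with a real interval of that length. Each edge of infinite length is identified with $[0,\infty]$, where the end $\infty$ is a vertex of valence $1$ (a point at infinity). The genus is $g = |E(\Gamma)|-|V(\Gamma)|+1$. A divisor on $\Gamma$ is a formal finite $\mathbb{Z}$-linear combination $D=\sum a_i p_i$ of points $p_i\in\Gamma$. Its degree is $\deg D = \sum a_i$. It is effective, written $D\ge 0$, if all $a_i\ge 0$. A rational function on $\Gamma$ is a continuous function $f:\Gamma\to\mathbb{R}\cup\{\pm\infty\}$, taking the values $\pm\infty$ only at points at infinity, whose restriction to each edge is piecewise linear with integer slopes and finitely many pieces. For $P\in\Gamma$, $\mathrm{ord}_P f$ is the sum of the slopes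 of $f$ along all segments outgoing from $P$. The principal divisor of $f$ is $(f)=\sum_{P\in\Gamma}\mathrm{ord}_P f\cdot P$. Two divisors are linearly equivalent, $D\sim E$, if $D-E$ is principal. The complete linear system of $D$ is $|D|=\{E \text{ divisor}: E\ge 0,\ E\sim D\}$. The rank is $\mathrm{rk}|D|=-1$ if $|D|=\emptyset$; otherwise it is the maximum of the integers $r\geq 0$ such that $|D-E|\ne\emptyset$ for every effective divisor $E$ of degree $r$. The canonical divisor is $K=\sum(\mathrm{val}(p)-2)p$, where $\mathrm{val}(p)$ is the valence of $p$ (a loop at $p$ counts twice; the sum is effectively over vertices, including points at infinity). A special divisor is an effective divisor $D$ such that $\mathrm{rk}|K-D|\ge 0$. A $g^1_2$ is a complete linear system $|E|$ of degree $2$ and rank $1$, and $\Gamma$ is hyperelliptic if it has a $g^1_2$. In genus at least $2$, a $g^1_2$ is unique if it exists, i.e. $E$ is unique up to linear equivalence. *)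

(* Defs.v *)
From HB Require Import structures.
From mathcomp Require Import all_boot all_order all_algebra.
From mathcomp Require Import all_classical all_reals all_analysis.
From mathcomp Require Import freeg.

Set Implicit Arguments.
Unset Strict Implicit.
Unset Printing Implicit Defensive.

Import Order.TTheory GRing.Theory Num.Theory.

Local Open Scope classical_set_scope.
Local Open Scope ring_scope.

(* A finite connected multigraph with edge lengths.  Each edge [e] carries an
   arbitrary choice of orientation, i.e. of an identification with the
   interval [0, len e] sending 0 to [src e] and [len e] to [tgt e]; edges of
   infinite length are oriented so that [tgt e] is the end at infinity. *)
Definition edge_valence (V E : finType) (src tgt : E -> V) (v : V) : nat :=
  (#|[set e | src e == v]%SET| + #|[set e | tgt e == v]%SET|)%N.

Definition edge_adj (V E : finType) (src tgt : E -> V) : rel V :=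
  fun u v => [exists e, (src e == u) && (tgt e == v)
                     || (src e == v) && (tgt e == u)].

Record tropical_curve (R : realType) := TropicalCurve {
  vertex : finType;
  edge : finType;
  src : edge -> vertex;
  tgt : edge -> vertex;
  len : edge -> \bar R;
  vertex_inhabited : (0 < #|vertex|)%N;
  curve_connected : forall u v, connect (edge_adj src tgt) u v;
  len_gt0 : forall e, (0 < len e)%E;
  infinite_end : forall e, len e = +oo%E -> edge_valence src tgt (tgt e) = 1%N
}.

Section TropicalCurves.
Variables (R : realType) (G : tropical_curve R).

Definition valence (v : vertex G) : nat := edge_valence (@src R G) (@tgt R G) v.

Definition genus : int := #|edge G|%:Z - #|vertex G|%:Z + 1.

Definition is_interior (p : edge G * R) : bool :=
  (0 < p.2) && (p.2%:E < len p.1)%E.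

Definition curve_point : Type := (vertex G + {p : edge G * R | is_interior p})%type.
HB.instance Definition _ := Choice.on curve_point.

(* The identification of [0, len e] with the edge [e], extended to \bar R by
   clamping; for +oo and -oo [fine] is 0 and the second branch applies. *)
Definition edge_pt (e : edge G) (t : \bar R) : curve_point :=
  if insub (e, fine t) is Some p then inr p
  else inl (if (t <= 0)%E then src e else tgt e).

Definition at_infinity (P : curve_point) : Prop :=
  exists2 e : edge G, len e = +oo%E & P = inl (tgt e).

Definition divisor := {freeg curve_point / int}.

Definition effective (D : divisor) : Prop := forall P, 0 <= coeff P D.

Definition affine_on (g : \bar R -> \bar R) (a b : \bar R) (m : int) : Prop :=
  exists c : R, forall x : R,
    (a < x%:E < b)%E -> g x%:E = (c + m%:~R * x)%:E.

(* [s] lists the break points: [g] is affine on every interval avoiding them. *)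
Definition integral_PL_on (g : \bar R -> \bar R) (l : \bar R) : Prop :=
  exists s : seq R, forall a b : \bar R, (0 <= a)%E -> (b <= l)%E ->
    (forall x, x \in s -> ~~ (a < x%:E < b)%E) -> exists m, affine_on g a b m.

(* Continuity for the quotient topology on the union of the edges is
   continuity along every edge. *)
Definition rational_function (f : curve_point -> \bar R) : Prop :=
  [/\ forall P, ~ at_infinity P -> f P \is a fin_num,
      forall e : edge G,
        {within [set t | (0 <= t <= len e)%E], continuous (f \o edge_pt e)}
    & forall e : edge G, integral_PL_on (f \o edge_pt e) (len e)].

(* Outgoing slopes of [g] at [t] towards larger and smaller parameters. *)
Definition slope_up (g : \bar R -> \bar R) (t : \bar R) : int :=
  xget 0 [set m | exists2 b, (t < b)%E & affine_on g t b m].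

Definition slope_down (g : \bar R -> \bar R) (t : \bar R) : int :=
  - xget 0 [set m | exists2 a, (a < t)%E & affine_on g a t m].

Definition ord (f : curve_point -> \bar R) (P : curve_point) : int :=
  match P with
  | inl v => \sum_(e | src e == v) slope_up (f \o edge_pt e) 0%E
           + \sum_(e | tgt e == v) slope_down (f \o edge_pt e) (len e)
  | inr p => let: (e, t) := val p in
             slope_up (f \o edge_pt e) t%:E + slope_down (f \o edge_pt e) t%:E
  end.

Definition principal (D : divisor) : Prop :=
  exists2 f, rational_function f & forall P, coeff P D = ord f P.

Definition lin_equiv (D E : divisor) : Prop := principal (D - E).

Definition linear_system (D : divisor) : set divisor :=
  [set E | effective E /\ lin_equiv E D].

Definition rank_set (D : divisor) : set nat :=
  [set r | forall E, effective E -> deg E = r%:Z -> linear_system (D - E) !=set0].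

(* [S `&` ubound S] is the set of maxima of [S]. *)
Definition rank (D : divisor) : int :=
  if `[< linear_system D = set0 >] then -1
  else (xget 0%N (rank_set D `&` ubound (rank_set D)))%:Z.

Definition canonical : divisor :=
  \sum_(v : vertex G) << ((valence v)%:Z - 2) *g (inl v : curve_point) >>.

Definition special (D : divisor) : Prop :=
  effective D /\ 0 <= rank (canonical - D).

Definition is_g12 (E : divisor) : Prop := deg E = 2 /\ rank E = 1.

Definition hyperelliptic : Prop := exists E, is_g12 E.

End TropicalCurves.

(* Main.v *)
From HB Require Import structures.
Require Import Defs.
From mathcomp Require Import all_boot all_order all_algebra.
From mathcomp Require Import all_classical all_reals all_analysis.
From mathcomp Require Import freeg.
From mathcomp Require Import zify ring lra.
Import Order.TTheory GRing.Theory Num.Theory.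
Import numFieldNormedType.Exports.
Local Open Scope classical_set_scope.
Local Open Scope ring_scope.

(** Clifford's inequality follows from half of the Riemann-Roch theorem, namely
    [rk (K - D) >= rk D - deg D + g - 1] ([riemann_roch_ge]).  Ranks are
    superadditive, so this bounds [rk D + (rk D - deg D + g - 1)] by [rk K], and
    the same inequality applied to [K] gives [rk K <= g - 1] since a divisor of
    negative degree has an empty linear system; hence [2 rk D <= deg D]
    ([clifford]).  For the case of equality, the inequality shows that a divisor
    of degree [2g - 2] and rank at least [g - 1] is equivalent to [K]
    ([canonical_unique]).  If [deg D = 2r] and [rk D = r], both
    [D + (g - 1 - r) E] and [(g - 1) E] are of this kind, and cancelling
    [(g - 1 - r) E] leaves [D ~ r E] ([clifford_eq]).

    Riemann-Roch itself rests on a dichotomy in the style of Baker and Norine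
    ([nonspecial_divisor]): if [|D|] is empty, there is a divisor [nu] of degree
    [g - 1] such that [nu - D] is equivalent to an effective divisor while
    [K - nu] is not.  The divisor [nu] is read off an orientation of the curve
    along a height function without flat pieces: its coefficient at a point is
    the number of descending directions minus one, and [K - nu] is the same
    divisor for the opposite height.  It has an empty linear system because a
    rational function making it effective could be maximal only on a set whose
    highest point receives a negative coefficient ([canonical_sub_orientation]).

    To produce the height, [D] is moved as close as possible to a base vertex
    [q].  No refinement of the curve is needed: on an edge the divisor of a
    rational function [f] matters only through two numbers, the total
    coefficient and the moment of the interior points, and [D] is principal
    exactly when vertex values and initial slopes satisfying a linear system
    [balanced] exist ([principal_balanced], [balanced_principal]).  Choosing
    slopes by rounding down, every real function on the vertices moves [D] to a
    divisor with at most one chip inside each edge.  The largest such function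
    vanishing at [q] and leaving no debt outside [q] exists as a supremum, and its
    maximality says that a fire started at [q] and stopped only by chips burns
    the whole graph (Dhar's criterion, [reduced_potential]); the order in which
    the vertices burn is the height. *)

Set Implicit Arguments.
Unset Strict Implicit.
Unset Printing Implicit Defensive.

(** * Reduced potentials on a weighted graph *)

Lemma small_pos (R : realType) (I : finType) (P : I -> R -> Prop) :
  (forall i, \forall e \near 0^'+, P i e) ->
  exists2 e : R, 0 < e & forall i, P i e.
Proof.
move=> nearP; have /filter_ex[e [e0 Pe]] :
    \forall e \near (0 : R)^'+, 0 < e /\ forall i, P i e.
  near=> e; split; first by near: e; exact: nbhs_right_gt.
  by near: e; exact: filter_forall.
by exists e.
Unshelve. all: by end_near. Qed.

Lemma floor_right (R : realType) (y l : R) : 0 < l ->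
  \forall e \near 0^'+, Num.floor (y + e / l) = Num.floor y.
Proof.
move=> l0; have /andP[fy fy1] := floor_itv y.
have d0 : 0 < ((Num.floor y + 1)%:~R - y) * l by rewrite mulr_gt0 // subr_gt0.
near=> e.
have e0 : 0 < e by near: e; exact: nbhs_right_gt.
have ed : e < ((Num.floor y + 1)%:~R - y) * l by near: e; exact: nbhs_right_lt.
apply: floor_def; rewrite (le_trans fy) ?lerDl ?divr_ge0 ?ltW //=.
by rewrite -ltrBrDl ltr_pdivrMr.
Unshelve. all: by end_near. Qed.

Lemma floor_left (R : realType) (y l : R) : 0 < l ->
  \forall e \near 0^'+,
    Num.floor y <= Num.floor (y - e / l) + (y \is a Num.int : nat)%:Z.
Proof.
move=> l0; have /andP[fy fy1] := floor_itv y.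
have [yint|yint] := boolP (y \is a Num.int).
  near=> e.
  have el : e < l by near: e; exact: nbhs_right_lt.
  rewrite -lerBlDr floor_ge_int rmorphB /= lerB //.
  by rewrite ler_pdivrMr // mul1r ltW.
have d0 : 0 < (y - (Num.floor y)%:~R) * l.
  by rewrite mulr_gt0 // subr_gt0 lt_neqAle fy -intrEfloor yint.
near=> e.
have ed : e < (y - (Num.floor y)%:~R) * l by near: e; exact: nbhs_right_lt.
by rewrite addr0 floor_ge_int lerBrDr -lerBrDl ler_pdivrMr // ltW.
Unshelve. all: by end_near. Qed.

(** The graph is given by its darts: [rev] exchanges the two orientations of an
    edge.  A potential [x] moves, along each dart, [floor (rise x h)] chips to
    its base, which is what a convex integral piecewise linear function does on
    an edge of length [L h]; the shifts [w] account for chips that were inside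
    the edges beforehand. *)
Section ReducedPotential.
Variables (R : realType) (V H : finType) (base head : H -> V) (rev : H -> H).
Variables (L w : H -> R) (b : V -> int) (q : V).
Hypotheses (revK : involutive rev) (base_rev : forall h, base (rev h) = head h).
Hypotheses (L_gt0 : forall h, 0 < L h) (L_rev : forall h, L (rev h) = L h).
Hypothesis cut : forall A : {set V}, q \in A -> A != [set: V]%SET ->
  exists2 h, base h \notin A & head h \in A.

Definition rise (x : V -> R) h : R := (x (head h) - x (base h) + w h) / L h.

Definition chips (x : V -> R) v : int :=
  b v + \sum_(h | base h == v) Num.floor (rise x h).

Lemma chips_le x y v :
  (forall h, base h = v -> x (head h) - x v <= y (head h) - y v) ->
  chips x v <= chips y v.
Proof.
move=> le_xy; rewrite lerD2l; apply: ler_sum => h /eqP bh.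
by rewrite le_floor // ler_pM2r ?invr_gt0 // lerD2r bh le_xy.
Qed.

(** Chips can always be fired from [A] until nobody outside [A] is in debt.  The
    induction removes from [A] a vertex [u] seen from the rest of [A]: lowering
    the potential off the smaller set helps [u] and harms no vertex outside [A]. *)
Lemma feasible_off (A : {set V}) : q \in A ->
  exists x, (forall v, v \in A -> x v = 0) /\
            (forall v, v \notin A -> 0 <= chips x v).
Proof.
have [n] := ubnP #|~: A|; elim: n A => // n IHn A ltn qA.
have [->|nT] := eqVneq A [set: V]%SET.
  by exists (fun=> 0); split=> // v; rewrite inE.
have [h0 uA hA] := cut qA nT.
set u := base h0 in uA.
have [||x [x0 xpos]] := IHn (u |: A)%SET; last first.
- pose k := `|chips x u|%N.
  pose c := L h0 * k%:R.
  have c_ge0 : 0 <= c by rewrite mulr_ge0 // ltW.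
  pose y v := if v \in A then x v else x v - c.
  have le_xy v : v \notin A -> forall w0, x w0 - x v <= y w0 - y v.
    by move=> vA w0; rewrite /y (negPf vA); case: ifP => _; lra.
  exists y; split=> [v vA|v vA]; first by rewrite /y vA x0 // !inE vA orbT.
  have [->{v vA}|vu] := eqVneq v u; last first.
    by apply: le_trans (xpos v _) (chips_le _) => *; [rewrite !inE negb_or vu | exact: le_xy].
  suff : chips x u + k%:Z <= chips y u by rewrite /k; lia.
  rewrite /chips -addrA lerD2l (bigD1 h0) //= [leRHS](bigD1 h0) //= addrAC.
  apply: lerD; last first.
    apply: ler_sum => h /andP[/eqP bh _].
    by rewrite le_floor // ler_pM2r ?invr_gt0 // lerD2r bh le_xy.
  have -> : rise y h0 = rise x h0 + k%:~R.
    rewrite /rise /y hA (negPf uA) /c; field.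
    by rewrite gt_eqF.
  by rewrite floorDrz ?intr_int // intrKfloor.
- by rewrite !inE qA orbT.
- rewrite -ltnS; apply: leq_trans ltn; rewrite ltnS.
  apply: proper_card; rewrite properE finset.setCS finset.subsetUr /=.
  by apply/subsetPn; exists u; rewrite ?inE ?eqxx // inE.
Qed.

(** The number of chips in circulation, shifts included, times a length that
    exceeds those of all edges: a bound for the drop of a feasible potential
    across an edge leaving a superlevel set. *)
Let C : R := (\sum_v `|b v|%:~R + \sum_h `|w h| / L h) * \sum_h L h.

Lemma inner_rise0 x (S : {set V}) :
  \sum_(h | (base h \in S) && (head h \in S)) (x (head h) - x (base h)) / L h = 0.
Proof.
set T := LHS; suff : T = - T by move=> /eqP; rewrite -addr_eq0 -mulr2n mulrn_eq0 => /eqP.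
have head_rev h : head (rev h) = base h by rewrite -base_rev revK.
rewrite {1}/T (reindex_inj (inv_inj revK)) /= -sumrN.
apply: eq_big => [h|h _]; first by rewrite base_rev head_rev andbC.
by rewrite base_rev head_rev L_rev -mulNr opprB.
Qed.

(** Summing the coefficients over a superlevel set [S], the darts inside [S]
    contribute at most their shifts, by antisymmetry, and the darts leaving [S]
    contribute negatively; nonnegativity of the sum therefore bounds the drop. *)
Lemma superlevel_gap x (S : {set V}) : q \notin S -> S != finset.set0 ->
  (forall v, v \in S -> 0 <= chips x v) ->
  (forall s t, s \in S -> t \notin S -> x t <= x s) ->
  exists2 s, s \in S & exists2 t, t \notin S & x s - x t <= C.
Proof.
move=> qS S0 Spos Sup.
have [||h0 sS tS] := cut (A := (~: S)%SET); rewrite ?inE //.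
  by apply: contra S0 => /eqP SC; rewrite -(finset.setCK S) SC finset.setCT.
rewrite !inE ?negbK in sS tS.
exists (base h0) => //; exists (head h0) => //.
have : 0 <= \sum_(v in S) (chips x v)%:~R :> R.
  by apply: sumr_ge0 => v vS; rewrite ler0z Spos.
have -> : \sum_(v in S) (chips x v)%:~R = \sum_(v in S) (b v)%:~R
     + \sum_(h | base h \in S) (Num.floor (rise x h))%:~R :> R.
  under eq_bigr do rewrite /chips rmorphD /= rmorph_sum /=.
  rewrite big_split /=; congr (_ + _).
  rewrite (partition_big base (mem S)) //=; apply: eq_bigr => v vS.
  by apply: eq_bigl => h; case: eqP => [->|]; rewrite ?vS ?andbF.
have leb : \sum_(v in S) (b v)%:~R <= \sum_v `|b v|%:~R :> R.
  apply: le_trans (_ : \sum_(v in S) `|b v|%:~R <= _).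
    by apply: ler_sum => v _; rewrite ler_int ler_norm.
  rewrite big_mkcond; apply: ler_sum => v _; case: ifP => // _.
have lew : \sum_(h | base h \in S) w h / L h <= \sum_h `|w h| / L h.
  apply: le_trans (_ : \sum_(h | base h \in S) `|w h| / L h <= _).
    by apply: ler_sum => h _; rewrite ler_pM2r ?invr_gt0 // ler_norm.
  by rewrite big_mkcond; apply: ler_sum => h _; case: ifP => // _; rewrite divr_ge0 // ltW.
have lef : \sum_(h | base h \in S) (Num.floor (rise x h))%:~R
   <= \sum_(h | base h \in S) w h / L h + (x (head h0) - x (base h0)) / L h0.
  apply: le_trans (_ : \sum_(h | base h \in S) (w h / L h + (x (head h) - x (base h)) / L h) <= _).
    by apply: ler_sum => h _; rewrite -mulrDl addrC floor_le.
  rewrite big_split lerD2l /= (bigID (fun h => head h \in S)) /= inner_rise0 add0r.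
  rewrite (bigD1 h0) /= ?sS ?tS // gerDl; apply: sumr_le0 => h /andP[/andP[hS hS'] _].
  by rewrite pmulr_lle0 ?invr_gt0 // subr_le0 Sup.
move=> ge0.
have : (x (base h0) - x (head h0)) / L h0 <= \sum_v `|b v|%:~R + \sum_h `|w h| / L h.
  by move: lef leb lew ge0; rewrite !mulrDl !mulNr; lra.
rewrite ler_pdivrMr // => /le_trans; apply.
apply: ler_wpM2l.
  by apply: addr_ge0; apply: sumr_ge0 => *; rewrite ?divr_ge0 // ltW.
by rewrite (bigD1 h0) //= lerDl sumr_ge0 // => h _; rewrite ltW.
Qed.

Definition feasible (x : V -> R) := x q = 0 /\ forall v, v != q -> 0 <= chips x v.

Lemma C_ge0 : 0 <= C.
Proof.
apply: mulr_ge0; last by apply: sumr_ge0 => h _; rewrite ltW.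
by apply: addr_ge0; apply: sumr_ge0 => *; rewrite ?divr_ge0 // ltW.
Qed.

(** The superlevel sets at heights [0, C, 2C, ...] strictly decrease as long as
    they are nonempty, so the last of them is empty. *)
Lemma feasible_bounded x v : feasible x -> x v <= C *+ #|V|.
Proof.
move=> [xq xpos].
pose S k := [set v | C *+ k < x v]%SET.
have qS k : q \notin S k by rewrite inE xq -leNgt mulrn_wge0 // C_ge0.
have cardS k : (#|S k| <= #|V| - k)%N.
  elim: k => [|k IHk]; first by rewrite subn0 max_card.
  have subS : (S k.+1 \subset S k).
    apply/fintype.subsetP => u; rewrite !inE; apply: le_lt_trans.
    by rewrite mulrSr lerDl C_ge0.
  have [S0|S0] := eqVneq (S k) finset.set0.
    by move: subS; rewrite S0 finset.subset0 => /eqP ->; rewrite cards0.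
  have [|s t|s sS [t tS gap]] := superlevel_gap (x := x) (qS k) S0.
  - by move=> u uS; apply: xpos; apply: contraTneq uS => ->.
  - by rewrite !inE -leNgt => sS /le_trans; apply; apply: ltW.
  suff : (S k.+1 \proper S k) by move=> /proper_card; lia.
  rewrite properE subS; apply/subsetPn; exists s => //.
  by move: tS; rewrite !inE -!leNgt mulrSr; lra.
have: v \notin S #|V|.
  by move: (cardS #|V|); rewrite subnn leqn0 cards_eq0 => /eqP ->; rewrite inE.
by rewrite inE -leNgt.
Qed.

(** The pointwise supremum of the feasible potentials. *)
Let values v := [set x v | x in feasible].
Let F v := sup (values v).

Lemma values_sup v : has_sup (values v).
Proof.
split; last by exists (C *+ #|V|) => _ [x fx <-]; exact: feasible_bounded.
have [|x [x0 xp]] := feasible_off (A := [set q]%SET); first by rewrite inE.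
exists (x v), x => //; split=> [|u uq]; first by rewrite x0 // inE.
by apply: xp; rewrite inE.
Qed.

Lemma feasible_le_F x v : feasible x -> x v <= F v.
Proof. by move=> fx; apply: ub_le_sup; [case: (values_sup v) | exists x]. Qed.

(** Rounding down is continuous on the right, so replacing [x] by [F] does not
    lower the coefficient at [v] once [x v] is close enough to [F v]. *)
Lemma chips_le_F x v :
  (forall w0, x w0 <= F w0) -> (forall h, base h = v ->
    Num.floor (rise F h + (F v - x v) / L h) = Num.floor (rise F h)) ->
  chips x v <= chips F v.
Proof.
move=> xF fl; rewrite lerD2l; apply: ler_sum => h /eqP bh.
rewrite -(fl h bh); apply: le_floor.
rewrite /rise bh -mulrDl ler_pM2r ?invr_gt0 //.
by have := xF (head h); lra.
Qed.

Lemma feasible_F : feasible F.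
Proof.
have [x0 fx0] : exists x, feasible x by have [[_ [x fx _]] _] := values_sup q; exists x.
split=> [|v vq].
  have := feasible_le_F q fx0; rewrite fx0.1 => F0; apply/le_anti; rewrite F0 andbT.
  by apply: ge_sup => [|_ [y [yq _] <-]]; [case: (values_sup q) | rewrite yq].
have [h|d d0 hd] := @small_pos R H
  (fun h d => forall e, 0 <= e < d -> Num.floor (rise F h + e / L h) = Num.floor (rise F h)).
  have /floor_right := L_gt0 h => /(_ (rise F h)) fl.
  near=> d => e /andP[e0 ed].
  apply/le_anti/andP; split; last by apply: le_floor; rewrite lerDl divr_ge0 // ltW.
  have <- : Num.floor (rise F h + d / L h) = Num.floor (rise F h) by near: d.
  by apply: le_floor; rewrite lerD2l ler_pM2r ?invr_gt0 // ltW.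
have [_ [x fx <-] xv] := sup_adherent d0 (values_sup v).
apply: le_trans (fx.2 v vq) _; apply: chips_le_F => [u|h _].
  exact: feasible_le_F.
apply: hd; rewrite subr_ge0 feasible_le_F //=.
by move: xv; rewrite /F; lra.
Unshelve. all: by end_near. Qed.

Definition chip_free x h : bool := rise x h \is a Num.int.

(** If no vertex outside [A] burned, raising [F] slightly outside [A] would keep
    it feasible: only the darts into [A] with an integral rise lose a chip. *)
Lemma burn (A : {set V}) : q \in A -> A != [set: V]%SET ->
  exists2 v, v \notin A &
    chips F v < \sum_(h | base h == v) ((head h \in A) && chip_free F h : nat)%:Z.
Proof.
move=> qA AT; apply: contrapT => noburn.
have [h|e e0 he] := @small_pos R H (fun h e => Num.floor (rise F h) <=
      Num.floor (rise F h - e / L h) + (chip_free F h : nat)%:Z).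
  exact: floor_left.
pose y v := if v \in A then F v else F v + e.
have [h0 uA _] := cut qA AT.
suff /feasible_le_F -/(_ (base h0)) : feasible y.
  by rewrite /y (negPf uA) gerDl leNgt e0.
split=> [|v vq]; first by rewrite /y qA feasible_F.1.
have [vA|vA] := boolP (v \in A).
  apply: le_trans (feasible_F.2 v vq) (chips_le _) => h _.
  by rewrite /y vA; case: ifP => _; lra.
have : \sum_(h | base h == v) ((head h \in A) && chip_free F h : nat)%:Z <= chips F v.
  by rewrite leNgt; apply/negP => lt; apply: noburn; exists v.
rewrite -subr_ge0 => /le_trans; apply.
rewrite -addrA lerD2l -sumrB; apply: ler_sum => h /eqP bh.
have [hA|hA] /= := boolP (head h \in A); last first.
  by rewrite subr0 le_floor // /rise /y bh (negPf vA) (negPf hA) opprD addrACA subrr addr0.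
rewrite lerBlDr; apply: le_trans (he h) _; rewrite lerD2r le_floor //.
rewrite /rise /y bh (negPf vA) hA -mulrBl ler_pM2r ?invr_gt0 //.
by lra.
Qed.

(** [rho] is the time at which a vertex burns, the vertices of [A] being on fire
    at the start. *)
Lemma burning_order_off (A : {set V}) : q \in A ->
  exists rho : V -> nat, (forall v, v \in A -> rho v = 0%N) /\
    forall v, v \notin A -> (0 < rho v)%N /\
      chips F v < \sum_(h | base h == v) ((rho (head h) < rho v)%N && chip_free F h : nat)%:Z.
Proof.
have [n] := ubnP #|~: A|; elim: n A => // n IHn A ltn qA.
have [->|nT] := eqVneq A [set: V]%SET.
  by exists (fun=> 0%N); split=> // v; rewrite inE.
have [u uA cu] := burn qA nT.
have [||rho [rho0 rhoP]] := IHn (u |: A)%SET.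
- rewrite -ltnS; apply: leq_trans ltn; rewrite ltnS.
  apply: proper_card; rewrite properE finset.setCS finset.subsetUr /=.
  by apply/subsetPn; exists u; rewrite ?inE ?eqxx // inE.
- by rewrite !inE qA orbT.
exists (fun v => if v \in A then 0%N else (rho v).+1); split=> [v ->//|v vA].
rewrite (negPf vA); split=> //.
have [->|vu] := eqVneq v u.
  apply: lt_le_trans cu _; apply: ler_sum => h _.
  by case: ifP => // _; case: ltnP.
have [|rv cv] := rhoP v; first by rewrite !inE negb_or vu.
apply: lt_le_trans cv _; apply: ler_sum => h _.
by case: ifP => _; rewrite ?ltnS //; case: (rho _ < _)%N.
Qed.

Theorem reduced_potential :
  exists x : V -> R, exists rho : V -> nat, forall v, v != q ->
    0 <= chips x v <
      \sum_(h | base h == v) ((rho (head h) < rho v)%N && chip_free x h : nat)%:Z.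
Proof.
have [|rho [_ rhoP]] := burning_order_off (A := [set q]%SET); first by rewrite inE.
exists F, rho => v vq; rewrite feasible_F.2 //=.
by case: (rhoP v) => //; rewrite inE.
Qed.

End ReducedPotential.

(** * Divisors seen through linear functionals *)

Section Functionals.
Variables (R : realType) (G : tropical_curve R).
Implicit Types (D : divisor G) (P : curve_point G) (e : edge G).

Definition total (M : zmodType) (phi : curve_point G -> M) D : M :=
  \sum_(P <- dom D) phi P *~ coeff P D.

(** The sum may run over any list containing the support, which makes additivity
    in [D] provable. *)
Lemma totalE (M : zmodType) (phi : curve_point G -> M) (S : seq (curve_point G)) D :
  uniq S -> {subset dom D <= S} -> total phi D = \sum_(P <- S) phi P *~ coeff P D.
Proof.
move=> uS sDS; rewrite (bigID (mem (dom D))) /= [X in _ = _ + X]big1 ?addr0; last first.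
  by move=> P PD; rewrite coeff_outdom // mulr0z.
rewrite -big_filter; apply: perm_big; apply: uniq_perm; rewrite ?uniq_dom ?filter_uniq //.
by move=> P; rewrite mem_filter /=; case: (boolP (P \in dom D)) => //= /sDS ->.
Qed.

Lemma total_is_additive (M : zmodType) (phi : curve_point G -> M) : additive (total phi).
Proof.
move=> D1 D2; pose S := undup (dom D1 ++ dom D2).
have uS : uniq S by exact: undup_uniq.
rewrite !(@totalE _ _ S) //; last 3 first.
- by move=> P PD; rewrite mem_undup mem_cat PD orbT.
- by move=> P PD; rewrite mem_undup mem_cat PD.
- by move=> P /domB; rewrite mem_undup.
by rewrite -sumrB; apply: eq_bigr => P _; rewrite coeffB mulrzBr.
Qed.

HB.instance Definition _ (M : zmodType) (phi : curve_point G -> M) :=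
  GRing.isZmodMorphism.Build (divisor G) M (total phi) (total_is_additive phi).

Lemma totalU (M : zmodType) (phi : curve_point G -> M) k P :
  total phi << k *g P >> = phi P *~ k.
Proof.
rewrite (@totalE _ _ [:: P]) ?big_seq1 ?coeffU ?eqxx ?mulr1 //.
move=> Q; have [->|k0] := eqVneq k 0; first by rewrite freegU0 dom0.
by rewrite domU.
Qed.

Lemma total_delta P D : total (fun Q => (Q == P)%:Z) D = coeff P D.
Proof.
have [PD|PD] := boolP (P \in dom D); last first.
  rewrite coeff_outdom // /total big_seq big1 // => Q QD.
  by rewrite (_ : Q == P = false) ?mul0rz //; apply: contraNF PD => /eqP <-.
rewrite /total (bigD1_seq P) ?uniq_dom //= eqxx intz big1 ?addr0 // => Q /negPf ->.
by rewrite mul0rz.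
Qed.

Lemma total_deg D : total (fun=> 1) D = deg D.
Proof.
rewrite -[in RHS](freeg_sumE D) raddf_sum /=.
by apply: eq_bigr => P _; rewrite degU intz.
Qed.

Lemma total_ge0 (N : numDomainType) (phi : curve_point G -> N) D :
  effective D -> (forall P, 0 <= phi P) -> 0 <= total phi D.
Proof. by move=> eD p0; apply: sumr_ge0 => P _; rewrite mulrz_ge0. Qed.

Definition on_edge e P : bool := if P is inr p then (val p).1 == e else false.
Definition pos P : R := if P is inr p then (val p).2 else 0.

(** Number of chips of the open edge [e] at distance less than [t] from its
    source. *)
Definition edge_deg e (t : \bar R) D : int :=
  total (fun P => (on_edge e P && ((pos P)%:E < t)%E)%:Z) D.

(** Value at [t] of the piecewise linear function on [e] that vanishes near the
    source and whose divisor on the open edge is that of [D]. *)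
Definition moment e (t : R) D : R :=
  total (fun P => if on_edge e P then Num.max 0 (t - pos P) else 0) D.

Lemma total_eq (M : zmodType) (phi psi : curve_point G -> M) D :
  (forall P, coeff P D != 0 -> phi P = psi P) -> total phi D = total psi D.
Proof. by move=> eq; rewrite /total !big_seq; apply: eq_bigr => P; rewrite mem_dom => /eq ->. Qed.

Lemma totalDphi (M : zmodType) (phi psi : curve_point G -> M) D :
  total (fun P => phi P + psi P) D = total phi D + total psi D.
Proof. by rewrite /total -big_split; apply: eq_bigr => P _; rewrite mulrzDl. Qed.

Lemma on_edge_itv e P : on_edge e P -> 0 < pos P /\ ((pos P)%:E < len e)%E.
Proof. by case: P => // -[[e' t] /= h] /eqP <-; case/andP: h. Qed.

Lemma edge_pt_interior e (t : R) : 0 < t -> (t%:E < len e)%E ->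
  exists2 p, edge_pt e t%:E = inr p & val p = (e, t).
Proof.
move=> t0 tl; rewrite /edge_pt; case: insubP => /= [p _ pE|]; first by exists p.
by rewrite /is_interior /= t0 tl.
Qed.

Lemma edge_pt0 e : edge_pt e 0%E = inl (src e).
Proof.
rewrite /edge_pt; case: insubP => /= [p|_]; first by rewrite /is_interior /= ltxx.
by rewrite lexx.
Qed.

Lemma edge_pt_len e : edge_pt e (len e) = inl (tgt e).
Proof.
rewrite /edge_pt; case: insubP => /= [p|_]; last by rewrite leNgt len_gt0.
rewrite /is_interior /=; have := len_gt0 e; case: (len e) => //= r.
  by rewrite ltxx andbF.
by rewrite ltxx.
Qed.

End Functionals.

(** * Slopes and end values of piecewise linear functions *)

Section Affine.
Variable R : realType.
Implicit Types (g : \bar R -> \bar R) (a b t : \bar R) (m : int).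

Lemma ereal_two_reals a b : (a < b)%E ->
  exists u, exists v, [/\ u < v :> R, (a < u%:E)%E & (v%:E < b)%E].
Proof.
case: a b => [a||] [b||] //= ab.
- exists ((2 * a + b) / 3), ((a + 2 * b) / 3).
  by move: ab; rewrite !lte_fin => ab; split; lra.
- by exists (a + 1), (a + 2); rewrite lte_fin ltry; split => //; lra.
- by exists (b - 2), (b - 1); rewrite lte_fin ltNyr; split => //; lra.
- by exists 0, 1; rewrite ltry ltNyr.
Qed.

Lemma affine_on_sub g a b a' b' m : (a <= a')%E -> (b' <= b)%E ->
  affine_on g a b m -> affine_on g a' b' m.
Proof.
move=> aa bb [c gc]; exists c => x /andP[ax xb]; apply: gc.
by rewrite (le_lt_trans aa) // (lt_le_trans xb).
Qed.

Lemma affine_slope_unique g a b m m' : (a < b)%E ->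
  affine_on g a b m -> affine_on g a b m' -> m = m'.
Proof.
move=> /ereal_two_reals[u [v [uv au vb]]] [c gc] [c' gc'].
have ub : (u%:E < b)%E by apply: lt_trans vb; rewrite lte_fin.
have av : (a < v%:E)%E by apply: lt_trans au _; rewrite lte_fin.
have := gc u; rewrite gc' au ub // => /(_ isT) [eu].
have := gc v; rewrite gc' av vb // => /(_ isT) [ev].
apply: (@intr_inj R); apply/eqP; rewrite -subr_eq0.
have : (m%:~R - m'%:~R) * (v - u) = 0 :> R by lra.
by move=> /eqP; rewrite mulf_eq0 (subr_eq0 v) (gt_eqF uv) orbF.
Qed.

Lemma slope_upE g t b m : (t < b)%E -> affine_on g t b m -> slope_up g t = m.
Proof.
move=> tb gm; apply: xget_subset1; first by exists b.
move=> m1 m2 [b1 tb1 gm1] [b2 tb2 gm2].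
apply: (@affine_slope_unique g t (Order.min b1 b2)); first by rewrite lt_min tb1.
  by apply: affine_on_sub gm1; rewrite // ge_min lexx.
by apply: affine_on_sub gm2; rewrite // ge_min lexx orbT.
Qed.

Lemma slope_downE g a t m : (a < t)%E -> affine_on g a t m -> slope_down g t = - m.
Proof.
move=> tb gm; congr (- _); apply: xget_subset1; first by exists a.
move=> m1 m2 [b1 tb1 gm1] [b2 tb2 gm2].
apply: (@affine_slope_unique g (Order.max b1 b2) t); first by rewrite gt_max tb1.
  by apply: affine_on_sub gm1; rewrite // le_max lexx.
by apply: affine_on_sub gm2; rewrite // le_max lexx orbT.
Qed.

Section EndValues.
Variables (g : \bar R -> \bar R) (l : \bar R).
Hypothesis gC : {within [set t | (0 <= t <= l)%E], continuous g}.

(** Uniqueness of limits: continuity within [[0, l]] transports an affine formula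
    to a limit point of the interval where it holds. *)
Lemma limit_value (F : set_system R) (FF : ProperFilter F) (p k m : R) :
  (0 <= p%:E <= l)%E -> F `=>` nbhs p ->
  (\forall x \near F, (0 <= x%:E <= l)%E /\ g x%:E = (k + m * x)%:E) ->
  g p%:E = (k + m * p)%:E.
Proof.
move=> Ap Fp gF; apply: (cvg_unique (@ereal_hausdorff R) (F := (g \o EFin) x @[x --> F])).
  move/subspace_continuousP : gC => /(_ p%:E Ap) gp W /gp /= /Fp.
  by apply: filterS2 gF => x [Ax _] /=; apply.
apply: cvg_trans (_ : (k + m * x)%:E @[x --> F] --> _).
  by apply: near_eq_cvg; apply: filterS gF => x [_ /= ->].
apply: cvg_EFin; first by apply: nearW => x.
by apply: cvgD; [exact: cvg_cst | apply: cvgM => //; exact: cvg_cst].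
Qed.

Lemma affine_left_value (p : R) t (k m : R) : 0 <= p -> (p%:E < t)%E -> (t <= l)%E ->
  (forall x, (p%:E < x%:E < t)%E -> g x%:E = (k + m * x)%:E) -> g p%:E = (k + m * p)%:E.
Proof.
move=> p0 pt tl gE; apply: (@limit_value p^'+).
- by rewrite lee_fin p0 /=; apply: le_trans _ tl; exact: ltW.
- exact: cvg_within.
have [u [v [uv pu vt]]] := ereal_two_reals pt.
near=> x.
have px : p < x by near: x; exact: nbhs_right_gt.
have xv : x < v by near: x; apply: nbhs_right_lt; rewrite lte_fin in pu; exact: lt_trans uv.
have xt : (x%:E < t)%E by apply: lt_trans vt; rewrite lte_fin.
split; last by apply: gE; rewrite lte_fin px.
by rewrite lee_fin (le_trans p0 (ltW px)) ltW //; apply: lt_le_trans tl.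
Unshelve. all: by end_near. Qed.

Lemma affine_right_value (p t k m : R) : 0 <= p -> p < t -> (t%:E <= l)%E ->
  (forall x, (p%:E < x%:E < t%:E)%E -> g x%:E = (k + m * x)%:E) -> g t%:E = (k + m * t)%:E.
Proof.
move=> p0 pt tl gE; apply: (@limit_value t^'-).
- by rewrite lee_fin tl andbT (le_trans p0) // ltW.
- exact: cvg_within.
near=> x.
have px : p < x by near: x; exact: nbhs_left_gt.
have xt : x < t by near: x; exact: nbhs_left_lt.
split; last by apply: gE; rewrite !lte_fin px.
by rewrite lee_fin (le_trans p0 (ltW px)) ltW //; apply: lt_le_trans tl; rewrite lte_fin.
Unshelve. all: by end_near. Qed.

End EndValues.
End Affine.

(** * Principal divisors are the balanced ones *)

Section Steps.
Variables (R : realType) (G : tropical_curve R).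
Implicit Types (D : divisor G) (P : curve_point G) (e : edge G).

(** The end of an infinite edge has valence one. *)
Lemma infinite_endE e e' : len e = +oo%E -> tgt e' = tgt e -> e' = e.
Proof.
move=> le te; have := infinite_end le; rewrite /edge_valence => val1.
have sub : ([set e; e'] \subset [set e0 | tgt e0 == tgt e])%SET.
  by apply/fintype.subsetP => x; rewrite !inE => /orP[] /eqP ->; rewrite ?te.
have := subset_leq_card sub; rewrite cards2; case: eqVneq => // _.
by move=> /= h; move: val1 h; set c1 := #|_|; set c2 := #|_|; lia.
Qed.

Lemma src_not_infinite e e' : len e = +oo%E -> src e' != tgt e.
Proof.
move=> le; have := infinite_end le; rewrite /edge_valence => val1.
apply/negP => se.
have h1 : (0 < #|[set e0 | src e0 == tgt e]%SET|)%N by apply/card_gt0P; exists e'; rewrite inE.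
have h2 : (0 < #|[set e0 | tgt e0 == tgt e]%SET|)%N by apply/card_gt0P; exists e; rewrite inE.
by move: val1 h1 h2; set c1 := #|_|; set c2 := #|_|; lia.
Qed.

Lemma sum_src_infinite (M : nmodType) (F : edge G -> M) e : len e = +oo%E ->
  \sum_(e' | src e' == tgt e) F e' = 0.
Proof. by move=> le; rewrite big_pred0 // => e'; rewrite (negPf (src_not_infinite e' le)). Qed.

Lemma sum_tgt_infinite (M : nmodType) (F : edge G -> M) e : len e = +oo%E ->
  \sum_(e' | tgt e' == tgt e) F e' = F e.
Proof.
by move=> le; rewrite (big_pred1 e) // => e'; apply/eqP/eqP => [|->//]; exact: infinite_endE.
Qed.

(** The variant of [edge_deg] that counts the chips at [p] itself: it gives the
    slope just after [p], as [edge_deg] gives the slope just before. *)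
Definition edge_deg_le e (p : R) D : int :=
  total (fun P => (on_edge e P && (pos P <= p))%:Z) D.

Lemma edge_deg_gap e (p : R) (t : \bar R) D : (p%:E < t)%E ->
  (forall P, on_edge e P -> p < pos P -> ((pos P)%:E < t)%E -> coeff P D = 0) ->
  edge_deg e t D = edge_deg_le e p D.
Proof.
move=> pt gap; apply: total_eq => P cP; have [oP|//] /= := boolP (on_edge e P).
congr ((_ : bool)%:Z); apply/idP/idP => [Pt|Pp].
  by rewrite leNgt; apply: contra_neqN cP => pP; apply: gap.
by apply: le_lt_trans pt; rewrite lee_fin.
Qed.

Lemma moment_gap e (p t : R) D : p <= t ->
  (forall P, on_edge e P -> p < pos P -> pos P < t -> coeff P D = 0) ->
  moment e t D = moment e p D + (edge_deg_le e p D)%:~R * (t - p).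
Proof.
move=> pt gap; rewrite /moment /edge_deg_le /total rmorph_sum /= mulr_suml -big_split /=.
rewrite !big_seq; apply: eq_bigr => P; rewrite mem_dom => cP.
have [oP|] /= := boolP (on_edge e P); last by rewrite !mul0rz mul0r addr0.
rewrite mulrzz intrM; have [Pp|pP] := lerP (pos P) p.
  rewrite !max_r ?subr_ge0 ?(le_trans Pp) // mul1r.
  by rewrite -[X in X = _]mulrzr -[X in _ = X + _]mulrzr; ring.
rewrite !mul0r addr0 !max_l ?subr_le0 ?(ltW pP) //.
by rewrite leNgt; apply: contra_neqN cP => Pt; apply: gap.
Qed.

Lemma edge_deg_leE e (p : R) D : 0 < p -> (p%:E < len e)%E ->
  edge_deg_le e p D = edge_deg e p%:E D + coeff (edge_pt e p%:E) D.
Proof.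
move=> p0 pl; rewrite -total_delta /edge_deg -totalDphi; apply: total_eq => P _.
have [q -> qE] := edge_pt_interior p0 pl.
case: P => [v|u] //=; rewrite lte_fin.
have -> : (inr u == inr q :> curve_point G) = ((val u).1 == e) && ((val u).2 == p).
  rewrite (inj_eq (@inr_inj _ _)) -(inj_eq val_inj) qE.
  by case: (val u) => e1 u1 /=; rewrite xpair_eqE.
by case: eqP => //= _; rewrite le_eqVlt; case: ltgtP.
Qed.

Lemma edge_deg_le0 e D : edge_deg_le e 0 D = 0.
Proof.
rewrite -[RHS](@big1_seq _ 0 +%R _ (dom D) xpredT (fun=> 0)) //.
apply: eq_bigr => P _; have [/on_edge_itv[P0 _]|_] /= := boolP (on_edge e P).
  by rewrite leNgt P0 mul0rz.
by rewrite mul0rz.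
Qed.

Lemma moment0 e D : moment e 0 D = 0.
Proof.
rewrite -[RHS](@big1_seq _ 0 +%R _ (dom D) xpredT (fun=> 0)) //.
apply: eq_bigr => P _; have [/on_edge_itv[P0 _]|_] /= := boolP (on_edge e P).
  by rewrite max_l ?mul0rz // sub0r oppr_le0 ltW.
by rewrite mul0rz.
Qed.

End Steps.

Lemma last_break (R : realType) (s : seq R) (t : \bar R) : (0 < t)%E ->
  exists p : R, [/\ 0 <= p, (p%:E < t)%E, (forall x, x \in s -> ~~ (p%:E < x%:E < t)%E)
    & p = 0 \/ p \in s].
Proof.
move=> t0; elim: s => [|x s [p [p0 pt gap pin]]]; first by exists 0; split => //; left.
have [/andP[px xt]|nx] := boolP (p%:E < x%:E < t)%E.
  exists x; split => //; first by rewrite (le_trans p0) // ltW.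
    move=> y; rewrite inE => /predU1P[->|/gap]; first by rewrite ltxx.
    by apply: contra => /andP[xy ->]; rewrite (lt_trans px).
  by right; rewrite inE eqxx.
exists p; split => // [y|]; first by rewrite inE => /predU1P[->|/gap].
by case: pin => [->|ps]; [left | right; rewrite inE ps orbT].
Qed.

Lemma count_lt (T : eqType) (a b : pred T) (s : seq T) x :
  subpred a b -> x \in s -> b x -> ~~ a x -> (count a s < count b s)%N.
Proof.
move=> ab + bx ax; elim: s => //= y s IHs; rewrite inE => /predU1P[<-|/IHs].
  by rewrite bx (negPf ax) add0n add1n ltnS sub_count.
by have := @ab y; case: (a y); case: (b y) => //=; lia.
Qed.

Section Forward.
Variables (R : realType) (G : tropical_curve R) (f : curve_point G -> \bar R).
Variable D : divisor G.
Hypotheses (fR : rational_function f) (fD : forall P, coeff P D = ord f P).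

Lemma coeff_affine e (a b : \bar R) m : affine_on (f \o edge_pt e) a b m ->
  forall P, on_edge e P -> (a < (pos P)%:E)%E -> ((pos P)%:E < b)%E -> coeff P D = 0.
Proof.
move=> fm [v|[[e1 t] /= ti]] //= /eqP ee at_ tb; rewrite -{}ee in fm.
rewrite fD /= (slope_upE tb (m := m)) ?(slope_downE at_ (m := m)) ?subrr //.
  by apply: affine_on_sub fm; rewrite // ltW.
by apply: affine_on_sub fm; rewrite // ltW.
Qed.

Let x v : R := fine (f (inl v)).
Let m0 e := slope_up (f \o edge_pt e) 0%E.

Lemma fin_srcE e : f (edge_pt e 0%E) = (x (src e))%:E.
Proof.
rewrite edge_pt0 /x fineK //; case: fR => finf _ _; apply: finf => -[e' le'].
by move=> [se]; move: (src_not_infinite e le'); rewrite se eqxx.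
Qed.

(** Taylor expansion along an edge: since the order of [f] at an interior point is
    its change of slope, [f] is determined by its value and slope at the source
    and by the chips passed on the way.  The induction is on the number of break
    points before [t]; [p] below is the last of them. *)
Lemma taylor e (t : \bar R) : (0 < t)%E -> (t <= len e)%E ->
  slope_down (f \o edge_pt e) t = - (m0 e + edge_deg e t D) /\
  forall r, t = r%:E ->
    f (edge_pt e t) = (x (src e) + (m0 e)%:~R * r + moment e r D)%:E.
Proof.
case: fR => _ /(_ e) fC /(_ e)[s sP].
have [n] := ubnP (count (fun y : R => y%:E < t)%E s); elim: n t => // n IHn t ltn t0 tl.
have [p [p0 pt gap pin]] := last_break s t0.
have pl : (p%:E < len e)%E by apply: lt_le_trans tl.
have p0' : (0 <= p%:E)%E by rewrite lee_fin.
have [m fm] := sP p%:E t p0' tl gap.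
have noP := coeff_affine fm.
have mE : m = m0 e + edge_deg_le e p D /\
   f (edge_pt e p%:E) = (x (src e) + (m0 e)%:~R * p + moment e p D)%:E.
  have [pE|pn0] := eqVneq p 0.
    by rewrite pE edge_deg_le0 moment0 !addr0 mulr0 addr0 fin_srcE /m0 -(slope_upE pt fm) pE.
  case: pin => [pE|ps]; first by rewrite pE eqxx in pn0.
  have pp : 0 < p by rewrite lt_neqAle eq_sym pn0.
  have [|||sd val] := IHn p%:E; rewrite ?lte_fin ?(ltW pl) //.
    rewrite ltnS in ltn; apply: leq_trans ltn; apply: (@count_lt _ _ _ _ p) => //=.
      by move=> y yp; apply: lt_trans pt.
    by rewrite ltxx.
  split; last exact: val.
  rewrite edge_deg_leE // fD.
  have [q -> qE] := edge_pt_interior pp pl.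
  by rewrite /= qE sd (slope_upE pt fm); lia.
case: mE => mE fp; split.
  by rewrite (slope_downE pt fm) mE (edge_deg_gap pt (D := D)) // => P oP *; apply: noP oP _ _; rewrite ?lte_fin.
move=> r tr; rewrite tr in pt tl fm gap noP *.
have pr : p < r by rewrite lte_fin in pt.
case: fm => c fm.
have fm' y : (p%:E < y%:E < r%:E)%E -> (f \o edge_pt e) y%:E = (c + m%:~R * y)%:E := fm y.
have := affine_left_value fC p0 pt tl fm'; rewrite /= fp => -[cE].
have := affine_right_value fC p0 pr tl fm'; rewrite /= => ->.
have -> := @moment_gap _ _ e p r D (ltW pr) noP.
by move: cE; rewrite mE intrD => cE; congr EFin; lra.
Qed.

End Forward.

(** Vertex values [x] and initial slopes [s] of a rational function with divisor
    [D].  The value at the far end of an infinite edge is unconstrained. *)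
Definition balanced (R : realType) (G : tropical_curve R) (D : divisor G)
    (x : vertex G -> R) (s : edge G -> int) : Prop :=
  (forall e r, len e = r%:E -> x (tgt e) - x (src e) = (s e)%:~R * r + moment e r D) /\
  (forall v, coeff (inl v) D =
     \sum_(e | src e == v) s e - \sum_(e | tgt e == v) (s e + edge_deg e (len e) D)).

Lemma principal_balanced (R : realType) (G : tropical_curve R) (D : divisor G) :
  principal D -> exists x s, balanced D x s.
Proof.
case=> f fR fD; exists (fun v => fine (f (inl v))), (fun e => slope_up (f \o edge_pt e) 0%E).
split=> [e r le|v].
  have [_ /(_ r le)] := taylor fR fD (len_gt0 e) (lexx _).
  by rewrite edge_pt_len => -> /=; ring.
rewrite fD /= -sumrN; congr (_ + _); apply: eq_bigr => e _.
by have [-> _] := taylor fR fD (len_gt0 e) (lexx _).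
Qed.

Lemma next_break (R : realType) (s : seq R) (t : R) (l : \bar R) : (t%:E < l)%E ->
  exists b : \bar R, [/\ (t%:E < b)%E, (b <= l)%E & forall x, x \in s -> ~~ (t%:E < x%:E < b)%E].
Proof.
move=> tl; elim: s => [|x s [b [tb bl gap]]]; first by exists l.
have [/andP[tx xb]|nx] := boolP (t%:E < x%:E < b)%E.
  exists x%:E; split => //; first by rewrite (le_trans _ bl) // ltW.
  move=> y; rewrite inE => /predU1P[->|/gap]; first by rewrite ltxx andbF.
  by apply: contra => /andP[-> yx]; rewrite (lt_trans yx).
by exists b; split => // y; rewrite inE => /predU1P[->|/gap].
Qed.

Section Backward.
Variables (R : realType) (G : tropical_curve R) (D : divisor G).
Variables (x : vertex G -> R) (s : edge G -> int).
Hypothesis bal : balanced D x s.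

(** The function built from the data [x], [s] on the edge [e].  To the left of [b],
    and beyond all breaks before [b], it is affine with constant term [cst e b];
    [ext e] is its limit along an infinite edge. *)
Let F e (t : R) : R := x (src e) + (s e)%:~R * t + moment e t D.
Let cst e (b : \bar R) : R := x (src e) +
  total (fun P => if on_edge e P && ((pos P)%:E < b)%E then - pos P else 0) D.
Let ext e : \bar R :=
  if (0 < s e + edge_deg e +oo%E D) then +oo%E
  else if (s e + edge_deg e +oo%E D < 0) then -oo%E else (cst e +oo%E)%:E.

Let f (P : curve_point G) : \bar R := match P with
  | inl v => if [pick e | (len e == +oo%E) && (tgt e == v)] is Some e then ext e
             else (x v)%:E
  | inr p => (F (val p).1 (val p).2)%:E
  end.

Let breaks e : seq R := [seq pos P | P <- dom D & on_edge e P].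

Let F_affine e (a b : \bar R) (t : R) :
  (forall y, y \in breaks e -> ~~ (a < y%:E < b)%E) -> (a < t%:E < b)%E ->
  F e t = cst e b + (s e + edge_deg e b D)%:~R * t.
Proof.
move=> gap /andP[at_ tb]; rewrite /F /cst /moment /edge_deg /total rmorphD rmorph_sum /=.
rewrite mulrDl mulr_suml -!addrA; congr (_ + _); rewrite addrCA; congr (_ + _).
rewrite -big_split /= !big_seq; apply: eq_bigr => P PD.
have [oP|_] /= := boolP (on_edge e P); last by rewrite !mul0rz mul0r addr0.
have /gap : pos P \in breaks e by apply: map_f; rewrite mem_filter oP.
rewrite mulrzz intrM -[X in X = _]mulrzr -[X in _ = X + _]mulrzr.
have [Pb|bP] /= := ltP (pos P)%:E b.
  rewrite andbT -leNgt => Pa; rewrite max_r; first by ring.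
  by rewrite subr_ge0 -lee_fin (le_trans Pa) // ltW.
rewrite andbF => _; rewrite max_l; first by ring.
by rewrite subr_le0 -lee_fin (le_trans _ bP) // ltW.
Qed.

Let f_src e : f (inl (src e)) = (x (src e))%:E.
Proof.
rewrite /=; case: pickP => // e' /andP[/eqP le' /eqP te'].
by have := src_not_infinite e le'; rewrite te' eqxx.
Qed.

Let f_tgt_fin e r : len e = r%:E -> f (inl (tgt e)) = (F e r)%:E.
Proof.
move=> le; have -> : F e r = x (tgt e) by rewrite /F -addrA -bal.1 //; ring.
rewrite /=; case: pickP => // e' /andP[/eqP le' /eqP te'].
by have := le'; rewrite -(infinite_endE le' (esym te')) le.
Qed.

Let f_tgt_inf e : len e = +oo%E -> f (inl (tgt e)) = ext e.
Proof.
move=> le; rewrite /=; case: pickP => [e' /andP[/eqP le' /eqP te']|/(_ e)].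
  by rewrite (infinite_endE le te').
by rewrite le !eqxx.
Qed.

Let fE e (t : R) : 0 <= t -> (t%:E <= len e)%E -> f (edge_pt e t%:E) = (F e t)%:E.
Proof.
move=> t0 tl; have [->|tn0] := eqVneq t 0.
  by rewrite edge_pt0 f_src /F mulr0 moment0 !addr0.
have [tE|tnl] := eqVneq t%:E (len e).
  by rewrite tE edge_pt_len; apply: f_tgt_fin.
have tp : 0 < t by rewrite lt_neqAle eq_sym tn0.
have [|p -> /= ->] := edge_pt_interior tp (e := e) => //.
by rewrite lt_neqAle tnl.
Qed.

Let F_cont e : continuous (F e).
Proof.
move=> t; apply: cvgD.
  by apply: cvgD; [exact: cvg_cst | apply: cvgM; [exact: cvg_cst | exact: cvg_id]].
rewrite /moment /total; apply: cvg_big => [|P _]; first exact: add_continuous.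
case: ifP => _; last by exact: cvg_cst.
under eq_fun do rewrite -mulrzr; rewrite -mulrzr; apply: cvgM; last exact: cvg_cst.
apply: (@continuous_max R R (fun=> 0) (fun u => u - pos P)); first exact: cvg_cst.
by apply: cvgB; [exact: cvg_id | exact: cvg_cst].
Qed.

Let h e (t : \bar R) : \bar R :=
  match t with r%:E => (F e r)%:E | +oo%E => ext e | -oo%E => 0%E end.

Let h_cont_fin e (r : R) : {for r%:E, continuous (h e)}.
Proof.
move=> W /= hW; rewrite /nbhs /= /ereal_nbhs /=.
have : (EFin \o F e) u @[u --> r] --> (F e r)%:E.
  by apply: cvg_EFin; [apply: nearW | exact: F_cont].
by move=> /(_ W hW).
Qed.

Let h_cont_inf e : {for +oo%E, continuous (h e)}.
Proof.
have [p [p0 _ gap _]] := last_break (breaks e) (ltry (0 : R)).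
have FE t : p < t -> F e t = cst e +oo%E + (s e + edge_deg e +oo%E D)%:~R * t.
  by move=> pt; apply: F_affine gap _; rewrite lte_fin pt ltry.
move=> W /=; rewrite /h /ext; set m := s e + _ in FE *.
have W' y : nbhs y W -> W y by exact: nbhs_singleton.
case: ltP => m0; [|case: ltP => m1].
(* beyond all breaks, a slope m >= 1 makes F grow at least as fast as t *)
- move=> hW; have := hW; rewrite {1}/nbhs /= => -[M [_ MW]].
  exists (Num.max p (Num.max 0 (M - cst e +oo%E))); split; first exact: num_real.
  move=> -[t||] //=.
    rewrite lte_fin !gt_max => /and3P[pt t0 tM]; apply: MW; rewrite FE // lte_fin.
    have : t <= m%:~R * t by rewrite ler_peMl ?(ltW t0) // ler1z.
    by lra.
  by move=> _; apply: W'; exact: hW.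
- move=> hW; have := hW; rewrite {1}/nbhs /= => -[M [_ MW]].
  exists (Num.max p (Num.max 0 (cst e +oo%E - M))); split; first exact: num_real.
  move=> -[t||] //=.
    rewrite lte_fin !gt_max => /and3P[pt t0 tM]; apply: MW; rewrite FE // lte_fin.
    have : t <= (- m)%:~R * t by rewrite ler_peMl ?(ltW t0) // ler1z; lia.
    by rewrite rmorphN /= mulNr; lra.
  by move=> _; apply: W'; exact: hW.
move=> hW; exists p; split; first exact: num_real.
  move=> -[t||] //=.
  by rewrite lte_fin => pt; rewrite FE // (_ : m = 0) ?mul0r ?addr0; [exact: W'|apply/le_anti; rewrite m0 m1].
by move=> _; apply: W'.
Qed.

Let f_h e t : (0 <= t <= len e)%E -> f (edge_pt e t) = h e t.
Proof.
move=> /andP[]; case: t => [t||] //= t0 tl; first exact: fE.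
have le : len e = +oo%E by apply/eqP; rewrite -leye_eq.
by rewrite -le edge_pt_len; exact: f_tgt_inf.
Qed.

Let f_affine e (a b : \bar R) : (0 <= a)%E -> (b <= len e)%E ->
  (forall y, y \in breaks e -> ~~ (a < y%:E < b)%E) ->
  affine_on (f \o edge_pt e) a b (s e + edge_deg e b D).
Proof.
move=> a0 bl gap; exists (cst e b) => t /[dup] /F_affine <- // /andP[at_ tb].
apply: fE; last by apply/ltW; exact: lt_le_trans bl.
by rewrite -lee_fin; apply/ltW; exact: le_lt_trans at_.
Qed.

Let f_slope_up e (t : R) : 0 <= t -> (t%:E < len e)%E ->
  slope_up (f \o edge_pt e) t%:E = s e + edge_deg_le e t D.
Proof.
move=> t0 tl; have [b [tb bl gap]] := next_break (breaks e) tl.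
rewrite (slope_upE tb (f_affine _ bl gap)) ?lee_fin // (@edge_deg_gap _ _ e t) //.
move=> P oP tP Pb; apply/eqP; apply: contraT => cP.
have /gap : pos P \in breaks e by apply: map_f; rewrite mem_filter oP mem_dom.
by rewrite lte_fin tP Pb.
Qed.

Let f_slope_down e (t : \bar R) : (0 < t)%E -> (t <= len e)%E ->
  slope_down (f \o edge_pt e) t = - (s e + edge_deg e t D).
Proof.
move=> t0 tl; have [p [p0 pt gap _]] := last_break (breaks e) t0.
by rewrite (slope_downE pt (f_affine _ tl gap)).
Qed.

Lemma balanced_principal : principal D.
Proof.
exists f; first split.
- case=> [v|p] //= nv; case: pickP => // e /andP[/eqP le /eqP tv].
  by case: nv; exists e; rewrite ?tv.
- move=> e; apply: (@subspace_eq_continuous _ _ _ (h e)).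
    by move=> t; rewrite inE => ht; rewrite /= -(f_h ht).
  apply: continuous_in_subspaceT => t; rewrite inE /= => /andP[].
  case: t => [t||] // _ _; [exact: h_cont_fin | exact: h_cont_inf].
- move=> e; exists (breaks e) => a b a0 bl gap.
  by exists (s e + edge_deg e b D); exact: f_affine.
case=> [v|[[e t] /= ti]].
  rewrite bal.2 /= -sumrN; congr (_ + _); apply: eq_bigr => e _.
    by rewrite f_slope_up ?len_gt0 // edge_deg_le0 addr0.
  by rewrite f_slope_down ?len_gt0.
have /andP[/= t0 tl] := ti.
rewrite f_slope_up ?ltW // f_slope_down ?lte_fin ?(ltW tl) // edge_deg_leE //.
have [p -> pE] := edge_pt_interior t0 tl.
rewrite (_ : exist _ _ _ = p); last exact: val_inj.
by ring.
Qed.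

End Backward.

(** * Divisors with at most one point inside each edge *)

Lemma sum_fibers (I J : finType) (M : nmodType) (p : I -> J) (F : I -> M) :
  \sum_j \sum_(i | p i == j) F i = \sum_i F i.
Proof. by rewrite [RHS](partition_big p xpredT). Qed.

Section Darts.
Variables (R : realType) (G : tropical_curve R).

Definition dart : finType := (edge G * bool)%type.
Definition base (h : dart) : vertex G := if h.2 then tgt h.1 else src h.1.
Definition head (h : dart) : vertex G := if h.2 then src h.1 else tgt h.1.
Definition rev (h : dart) : dart := (h.1, ~~ h.2).

Lemma dart_sum (M : nmodType) (F : dart -> M) v :
  \sum_(h | base h == v) F h =
  \sum_(e | src e == v) F (e, false) + \sum_(e | tgt e == v) F (e, true).
Proof.
rewrite big_mkcond [X in _ = X + _]big_mkcond [X in _ = _ + X]big_mkcond -big_split /=.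
transitivity (\sum_e \sum_b (if base (e, b) == v then F (e, b) else 0)).
  by rewrite pair_bigA; apply: eq_bigr => -[].
by apply: eq_bigr => e _; rewrite big_bool /= addrC.
Qed.

Lemma cut_dart q (A : {set vertex G}) : q \in A -> A != [set: vertex G]%SET ->
  exists2 h : dart, base h \notin A & head h \in A.
Proof.
move=> qA; apply: contraNP => nocut.
have closedA : fingraph.closed (edge_adj (@src R G) (@tgt R G)) (mem A).
  move=> u v /existsP[e uv]; apply: contrapT => /eqP neq; apply: nocut.
  have [sA|sA] := boolP (src e \in A); have [tA|tA] := boolP (tgt e \in A).
  - by case/orP: uv neq => /andP[/eqP <- /eqP <-] /=; rewrite sA tA.
  - by exists (e, true).
  - by exists (e, false).
  - by case/orP: uv neq => /andP[/eqP <- /eqP <-] /=; rewrite (negPf sA) (negPf tA).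
apply/eqP/setP => v; rewrite inE.
by rewrite -[LHS](closed_connect closedA (curve_connected q v)).
Qed.

Lemma finite_vertex : exists q : vertex G, forall e, len e = +oo%E -> tgt e != q.
Proof.
have /card_gt0P[v _] := vertex_inhabited G.
have [[e /andP[/eqP le /eqP te]]|nv] :=
    pselect (exists e, (len e == +oo%E) && (tgt e == v)).
  by exists (src e) => e' le'; rewrite eq_sym src_not_infinite.
by exists v => e le; apply/negP => /eqP te; apply: nv; exists e; rewrite le te !eqxx.
Qed.

Lemma valenceE v : (valence v)%:Z = \sum_(h : dart | base h == v) 1.
Proof.
by rewrite dart_sum !sumr_const /valence /edge_valence !cardsE PoszD !natz.
Qed.

End Darts.

Section VertexEdgeDivisors.
Variables (R : realType) (G : tropical_curve R).
Implicit Types (a : vertex G -> int) (z : edge G -> int) (c : edge G -> R).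

Definition ve_divisor a z c : divisor G :=
  \sum_v << a v *g (inl v : curve_point G) >> + \sum_e << z e *g edge_pt e (c e)%:E >>.

Lemma total_ve (M : zmodType) (phi : curve_point G -> M) a z c :
  total phi (ve_divisor a z c) =
    \sum_v phi (inl v) *~ a v + \sum_e phi (edge_pt e (c e)%:E) *~ z e.
Proof.
by rewrite raddfD !raddf_sum /=; congr (_ + _); apply: eq_bigr => ? _; rewrite totalU.
Qed.

Lemma ve_divisorB a z a' z' c : ve_divisor a z c - ve_divisor a' z' c =
  ve_divisor (fun v => a v - a' v) (fun e => z e - z' e) c.
Proof.
rewrite /ve_divisor opprD addrACA -!sumrB.
by congr (_ + _); apply: eq_bigr => ? _; rewrite freegUB.
Qed.

Lemma canonical_ve c : Defs.canonical G = ve_divisor (fun v => (valence v)%:Z - 2) (fun=> 0) c.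
Proof.
by rewrite /ve_divisor [X in _ = _ + X]big1 ?addr0 // => e _; rewrite freegU0.
Qed.

Lemma deg_ve a z c : deg (ve_divisor a z c) = \sum_v a v + \sum_e z e.
Proof.
by rewrite -total_deg total_ve; congr (_ + _); apply: eq_bigr => ? _; rewrite intz.
Qed.

Lemma effective_ve a z c : (forall v, 0 <= a v) -> (forall e, 0 <= z e) ->
  effective (ve_divisor a z c).
Proof.
move=> a0 z0 P; rewrite coeffD !raddf_sum /=.
by apply: addr_ge0; apply: sumr_ge0 => ? _; rewrite coeffU mulr_ge0.
Qed.

Section Values.
Variables (a : vertex G -> int) (z : edge G -> int) (c : edge G -> R).
Hypothesis zc : forall e, z e != 0 -> 0 < c e /\ ((c e)%:E < len e)%E.

Lemma coeff_ve v : coeff (inl v) (ve_divisor a z c) = a v.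
Proof.
rewrite -total_delta total_ve (bigD1 v) //= eqxx intz !big1 ?addr0 // => [e _|u uv].
  have [->|/zc[c0 cl]] := eqVneq (z e) 0; first by rewrite mulr0z.
  by have [p -> _] := edge_pt_interior c0 cl; rewrite mul0rz.
by rewrite (inj_eq (@inl_inj _ _)) (negPf uv) mul0rz.
Qed.

Lemma edge_total_ve (M : zmodType) (psi : R -> M) e :
  total (fun P => if on_edge e P then psi (pos P) else 0) (ve_divisor a z c) =
    psi (c e) *~ z e.
Proof.
rewrite total_ve (bigD1 e) //= [X in X + _]big1 => [|v _]; last by rewrite mul0rz.
rewrite [X in _ + (_ + X)]big1 ?addr0 ?add0r => [|e' ne].
  have [->|/zc[c0 cl]] := eqVneq (z e) 0; first by rewrite !mulr0z.
  by have [p -> /= pE] := edge_pt_interior c0 cl; rewrite pE eqxx.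
have [->|/zc[c0 cl]] := eqVneq (z e') 0; first by rewrite !mulr0z.
by have [p -> /= pE] := edge_pt_interior c0 cl; rewrite pE (negPf ne) mul0rz.
Qed.

Lemma edge_deg_ve e : edge_deg e (len e) (ve_divisor a z c) = z e.
Proof.
rewrite -[RHS]intz -(edge_total_ve (fun=> 1)).
by apply: total_eq => P _; have [/on_edge_itv[_ ->]|] //= := boolP (on_edge e P).
Qed.

Lemma moment_ve e r : len e = r%:E -> moment e r (ve_divisor a z c) = (r - c e) *~ z e.
Proof.
move=> le; have [z0|/[dup] z0 /zc[c0 cl]] := eqVneq (z e) 0.
  by rewrite /moment (edge_total_ve (fun y => Num.max 0 (r - y))) z0 !mulr0z.
rewrite /moment (edge_total_ve (fun y => Num.max 0 (r - y))) max_r //.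
by rewrite subr_ge0 -lee_fin -le ltW.
Qed.

End Values.
End VertexEdgeDivisors.

Section FunctionalBounds.
Variables (R : realType) (G : tropical_curve R) (D : divisor G) (e : edge G).

Lemma edge_degB t D1 D2 : edge_deg e t (D1 - D2) = edge_deg e t D1 - edge_deg e t D2.
Proof. exact: raddfB. Qed.

Lemma momentB r D1 D2 : moment e r (D1 - D2) = moment e r D1 - moment e r D2.
Proof. exact: raddfB. Qed.

Lemma edge_degD t D1 D2 : edge_deg e t (D1 + D2) = edge_deg e t D1 + edge_deg e t D2.
Proof. exact: raddfD. Qed.

Lemma momentD r D1 D2 : moment e r (D1 + D2) = moment e r D1 + moment e r D2.
Proof. exact: raddfD. Qed.

Hypothesis D_ge0 : effective D.

Lemma edge_deg_ge0 t : 0 <= edge_deg e t D.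
Proof. by apply: total_ge0. Qed.

Lemma moment_ge0 r : 0 <= moment e r D.
Proof. by apply: total_ge0 => // P; case: ifP => // _; rewrite le_max lexx. Qed.

(** Each chip of [e] is at positive distance from the source, hence at distance
    less than [r] from the target. *)
Lemma moment_le r : len e = r%:E -> moment e r D <= (edge_deg e (len e) D)%:~R * r.
Proof.
move=> le; rewrite /moment /edge_deg /total rmorph_sum /= mulr_suml.
apply: ler_sum => P _; rewrite mulrzz intrM -mulrzr mulrAC.
apply: ler_wpM2r; first by rewrite ler0z.
have [oP|] := boolP (on_edge e P); last by rewrite mul0r.
have [p0 pl] := on_edge_itv oP; rewrite pl mul1r.
by rewrite ge_max -lee_fin -le (ltW (len_gt0 e)) lerBlDr lerDl ltW.
Qed.

End FunctionalBounds.

(** * Linear equivalence as a group relation *)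

Section PrincipalGroup.
Variables (R : realType) (G : tropical_curve R).
Implicit Types D : divisor G.

Lemma balancedN D x s : balanced D x s -> balanced (- D) (fun v => - x v) (fun e => - s e).
Proof.
move=> [xs Ds]; split=> [e r le|v].
  have := xs e r le; rewrite /moment raddfN /= rmorphN /=; lra.
rewrite coeffN Ds opprD -sumrN; congr (_ - _); rewrite -sumrN.
by apply: eq_bigr => e _; rewrite /edge_deg raddfN /= opprD.
Qed.

Lemma balancedD D1 D2 x1 s1 x2 s2 : balanced D1 x1 s1 -> balanced D2 x2 s2 ->
  balanced (D1 + D2) (fun v => x1 v + x2 v) (fun e => s1 e + s2 e).
Proof.
move=> [xs1 Ds1] [xs2 Ds2]; split=> [e r le|v].
  by have := xs1 e r le; have := xs2 e r le; rewrite momentD; rewrite intrD; lra.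
rewrite coeffD Ds1 Ds2 addrACA -opprD; congr (_ - _); first by rewrite -big_split.
by rewrite -big_split /=; apply: eq_bigr => e _; rewrite edge_degD addrACA.
Qed.

Lemma balanced0 : balanced (0 : divisor G) (fun=> 0) (fun=> 0).
Proof.
split=> [e r _|v]; first by rewrite /moment raddf0 /=; ring.
by rewrite coeff0 !big1 ?subrr // => e _; rewrite /edge_deg raddf0.
Qed.

Lemma principal0 : principal (0 : divisor G).
Proof. exact: balanced_principal balanced0. Qed.

Lemma principalN D : principal D -> principal (- D).
Proof.
by move=> /principal_balanced[x [s /balancedN]]; exact: balanced_principal.
Qed.

Lemma principalD D1 D2 : principal D1 -> principal D2 -> principal (D1 + D2).
Proof.
move=> /principal_balanced[x1 [s1 b1]] /principal_balanced[x2 [s2 b2]].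
exact: balanced_principal (balancedD b1 b2).
Qed.

(** Both sides are additive in [D], and agree on points. *)
Lemma deg_sum D : deg D = \sum_v coeff (inl v) D + \sum_e edge_deg e (len e) D.
Proof.
rewrite -total_deg -[D in RHS]freeg_sumE.
under eq_bigr do rewrite raddf_sum /=.
rewrite exchange_big /=.
under [X in _ + X]eq_bigr do rewrite /edge_deg raddf_sum /=.
rewrite [X in _ + X]exchange_big /= -big_split /=; apply: eq_bigr => P _.
rewrite intz; under eq_bigr do rewrite coeffU.
under [X in _ + X]eq_bigr do rewrite totalU mulrzz mulrC.
case: P => [v|p].
  rewrite (bigD1 v) //= eqxx mulr1 big1 => [|u uv]; last first.
    by rewrite (inj_eq (@inl_inj _ _)) eq_sym (negPf uv) mulr0.
  by rewrite addr0 big1 ?addr0 // => e _; rewrite mulr0.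
rewrite big1 ?add0r => [|v _]; last by rewrite mulr0.
rewrite (bigD1 (val p).1) //= eqxx big1 => [|e /negPf ne]; last first.
  by rewrite eq_sym ne mulr0.
by have /andP[_ ->] := valP p; rewrite mulr1 addr0.
Qed.

(** The outgoing slopes at the two ends of an edge add up to minus the number of
    chips inside it. *)
Lemma principal_deg D : principal D -> deg D = 0.
Proof.
move=> /principal_balanced[x [s [_ Ds]]]; rewrite deg_sum.
under eq_bigr do rewrite Ds.
by rewrite sumrB !sum_fibers big_split /= opprD addrA subrr sub0r addNr.
Qed.

End PrincipalGroup.

(** * Orientation divisors *)

Lemma slope_le (R : realType) (k : int) (r t : R) (strict : bool) : 0 < r ->
  k%:~R * r <= t -> (if strict then t < 0 else t <= 0) -> k <= - (strict : nat)%:Z.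
Proof.
case: strict => r0 kr t0.
  have : k%:~R < 0 :> R by rewrite -(pmulr_llt0 _ r0) (le_lt_trans kr).
  by rewrite ltrz0 /=; lia.
have : k%:~R <= 0 :> R by rewrite -(pmulr_lle0 _ r0) (le_trans kr).
by rewrite lerz0 /=; lia.
Qed.

(** The combinatorial trace of a height function: it takes the value [rho v] at
    [v], has a single local maximum at distance [c e] from the source of each
    peaked edge [e], and is strictly monotone on the other edges. *)
Section Orientation.
Variables (R : realType) (G : tropical_curve R).
Variables (rho : vertex G -> nat) (peaked : pred (edge G)) (c : edge G -> R).
Hypothesis peak_interior : forall e, peaked e -> 0 < c e /\ ((c e)%:E < len e)%E.
Hypothesis unpeaked_slanted : forall e, ~~ peaked e -> rho (src e) != rho (tgt e).
Hypothesis infinite_ascending : forall e, len e = +oo%E ->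
  ~~ peaked e /\ (rho (src e) < rho (tgt e))%N.

Definition descending (h : dart G) : bool :=
  ~~ peaked h.1 && (rho (head h) < rho (base h))%N.

Definition descents v : int := \sum_(h : dart G | base h == v) (descending h : nat)%:Z.

Let pk e : int := (peaked e : nat)%:Z.

Definition orientation_divisor : divisor G := ve_divisor (fun v => descents v - 1) pk c.

Let pk_interior e : pk e != 0 -> 0 < c e /\ ((c e)%:E < len e)%E.
Proof. by rewrite /pk => pe; apply: peak_interior; move: pe; case: (peaked e). Qed.

(** An edge descends from exactly one of its ends, or contains a peak. *)
Lemma deg_orientation : deg orientation_divisor = genus G - 1.
Proof.
rewrite deg_ve sumrB /descents sum_fibers.
rewrite (_ : \sum_h _ = \sum_e \sum_o (descending (e, o) : nat)%:Z); last first.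
  by rewrite pair_bigA; apply: eq_bigr => -[].
rewrite addrAC -big_split /= sumr_const /genus.
rewrite (eq_bigr (fun=> 1)) => [|e _]; first by rewrite sumr_const !natz addrK.
rewrite big_bool /pk /descending /head /base /=; have := @unpeaked_slanted e.
by case: (peaked e) => //= /(_ isT); case: ltngtP.
Qed.

(** The ends at infinity are left out of the comparison, because a rational
    function may be infinite there. *)
Lemma lex_max_vertex (y : vertex G -> R) :
  exists2 v, (forall e, len e = +oo%E -> tgt e != v) &
    forall u, (forall e, len e = +oo%E -> tgt e != u) ->
      y u <= y v /\ (y u = y v -> (rho u <= rho v)%N).
Proof.
pose fin u := [forall e : edge G, (len e == +oo%E) ==> (tgt e != u)].
have finP u : reflect (forall e, len e = +oo%E -> tgt e != u) (fin u).
  by apply: (iffP forallP) => [h e /eqP le|h e];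
     [have := h e; rewrite le | apply/implyP => /eqP /h].
have [q /finP qfin] := finite_vertex G.
have [v1 fv1 max1] := @Order.TotalTheory.arg_maxP _ _ _ q fin y qfin.
have fv1' : fin v1 && (y v1 == y v1) by rewrite fv1 eqxx.
have [v /andP[/finP fv /eqP yv] max2] :=
  @arg_maxnP _ v1 (fun u => fin u && (y u == y v1)) rho fv1'.
exists v => // u /finP fu; rewrite yv; split=> [|yu]; first exact: max1.
by apply: max2; rewrite fu yu eqxx.
Qed.

(** The coefficient of [K - nu] at a vertex is the number of ascending directions
    minus one, and it is [-1] at a peak.  Suppose that a rational function with
    vertex values [y] made it effective; it is convex on each edge, strictly so
    at a peak.  At a vertex [v] where [(y, rho)] is maximal for the lexicographic
    order, its slope is therefore at most [-1] in every ascending direction and at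
    most [0] in the others, which leaves a negative coefficient at [v]. *)
Theorem canonical_sub_orientation :
  ~ (linear_system (Defs.canonical G - orientation_divisor) !=set0).
Proof.
rewrite (canonical_ve c) ve_divisorB.
move=> [E [E_ge0 /principal_balanced[y [s [ys Es]]]]].
pose asc h : int := (~~ descending h : nat)%:Z.
have pkN e : 0 - pk e != 0 -> 0 < c e /\ ((c e)%:E < len e)%E.
  by rewrite sub0r oppr_eq0; exact: pk_interior.
have balE v : coeff (inl v) E + 1 - \sum_(h : dart G | base h == v) asc h =
    \sum_(e | src e == v) s e -
    \sum_(e | tgt e == v) (s e + (edge_deg e (len e) E + pk e)).
  have -> : \sum_(h : dart G | base h == v) asc h = (valence v)%:Z - descents v.
    by rewrite valenceE -sumrB; apply: eq_bigr => h _; rewrite /asc; case: descending.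
  have Ev := Es v; rewrite coeffB (coeff_ve _ pkN) in Ev.
  transitivity (coeff (inl v) E - ((valence v)%:Z - 2 - (descents v - 1))); first by lia.
  rewrite Ev; congr (_ - _); apply: eq_bigr => e _.
  by rewrite edge_degB (edge_deg_ve _ pkN) sub0r opprK.
have ysE e r : len e = r%:E ->
    y (tgt e) - y (src e) = (s e)%:~R * r + (moment e r E + (pk e)%:~R * (r - c e)).
  move=> le; rewrite (ys e r le) momentB (moment_ve _ pkN le).
  by rewrite sub0r mulrNz opprK -[(r - c e) *~ pk e]mulrzl.
have [v vfin vmax] := lex_max_vertex y.
(* the condition of [slope_le] at the end [v] of an edge whose other end is [u];
   [m] measures the failure of [y] to be affine on the edge *)
have drop_strict u (e : edge G) (m d : R) :
    (forall e', len e' = +oo%E -> tgt e' != u) -> 0 <= m -> 0 < d ->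
    (~~ peaked e -> rho u != rho v) ->
    let t := y u - y v - (m + (pk e)%:~R * d) in
    if ~~ (~~ peaked e && (rho u < rho v)%N) then t < 0 else t <= 0.
  move=> ufin m0 d0 neq /=; have [yle rle] := vmax u ufin.
  rewrite /pk; case: (boolP (peaked e)) neq => [pe _|npe /(_ isT) neq] /=.
    by rewrite mul1r; lra.
  rewrite mul0r addr0; case: ltnP => [_|le_rho] /=; first by lra.
  have [yeq|yne] := eqVneq (y u) (y v).
    by have := rle yeq; move: neq; rewrite neq_ltn; lia.
  have : y u < y v by rewrite lt_neqAle yne yle.
  by lra.
have finite_len (e : edge G) : len e != +oo%E -> exists2 r, len e = r%:E & 0 < r.
  by have := len_gt0 e; case: (len e) => // r r0 _; exists r.
have outflow e : src e = v -> s e <= - asc (e, false).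
  move=> ev; have [le|le] := eqVneq (len e) +oo%E.
    (* the coefficient [-1] of [K - nu] at the far end forces a slope [-1] *)
    have [npe lt_rho] := infinite_ascending le.
    have := balE (tgt e); rewrite dart_sum !sum_src_infinite // !sum_tgt_infinite //.
    rewrite /asc /descending /base /head /= npe lt_rho ltnNge (ltnW lt_rho) /=.
    have := E_ge0 (inl (tgt e)); have := edge_deg_ge0 e E_ge0 (len e).
    rewrite /pk (negPf npe); set k := edge_deg _ _ _.
    by move: (coeff _ _) k => c1 k; lia.
  have [r lr r0] := finite_len e le.
  rewrite /asc /descending /base /head /= ev.
  apply: (slope_le r0 _ (drop_strict (tgt e) e (moment e r E)
     (if peaked e then r - c e else 1) _ _ _ _)) => [||||npe].
  - by rewrite -ev; have := ysE e r lr; rewrite /pk; case: (peaked e) => /=; lra.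
  - by move=> e' le'; apply: contra_neqN le => /eqP /esym /(infinite_endE le') ->.
  - exact: moment_ge0.
  - by case: ifP => // /peak_interior[_]; rewrite lr lte_fin subr_gt0.
  - by rewrite -ev eq_sym unpeaked_slanted.
have inflow e : tgt e = v -> - (s e + (edge_deg e (len e) E + pk e)) <= - asc (e, true).
  move=> ev; have le : len e != +oo%E by apply/eqP => /vfin; rewrite ev eqxx.
  have [r lr r0] := finite_len e le.
  rewrite /asc /descending /base /head /= ev.
  apply: (slope_le r0 _ (drop_strict (src e) e
     ((edge_deg e (len e) E)%:~R * r - moment e r E)
     (if peaked e then c e else 1) _ _ _ _)) => [||||npe].
  - rewrite -ev rmorphN /= !intrD; have := ysE e r lr.
    by rewrite /pk; case: (peaked e) => /=; lra.
  - by move=> e' le'; rewrite eq_sym src_not_infinite.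
  - by rewrite subr_ge0 moment_le.
  - by case: ifP => // /peak_interior[].
  - by rewrite -ev unpeaked_slanted.
have := balE v; rewrite dart_sum -sumrN => eqv.
suff : coeff (inl v) E + 1 <= 0.
  by rewrite -lerBrDr sub0r => /(le_trans (E_ge0 (inl v))).
move/eqP: eqv; rewrite subr_eq addrACA => /eqP ->.
rewrite -[leRHS]addr0; apply: lerD; rewrite -big_split; apply: sumr_le0 => e /eqP.
  by move/outflow; rewrite lerNr => ?; rewrite -lerBrDr sub0r lerNr.
by move/inflow; rewrite lerNr => ?; rewrite -lerBrDr sub0r lerNr.
Qed.

End Orientation.

(** * The dichotomy between a divisor and nonspecial divisors *)

Section Nonspecial.
Variables (R : realType) (G : tropical_curve R) (D : divisor G).

(** The weighted graph on which [D] is reduced.  Chips inside an edge are pushed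
    to its target, at the price of the shift [w].  An infinite edge is given
    length 1 and the shift for which equal potentials at its ends send all the
    chips of the edge and of its far end to the source. *)
Let ell (e : edge G) : R := if len e is r%:E then r else 1.
Let n e : int := edge_deg e (len e) D.
Let w e : R := if len e is r%:E then moment e r D else (coeff (inl (tgt e)) D + n e)%:~R.
Let L (h : dart G) : R := ell h.1.
Let W (h : dart G) : R := if h.2 then - w h.1 else w h.1.
Let b v : int := coeff (inl v) D + \sum_(e | tgt e == v) n e.

Let ell_gt0 e : 0 < ell e.
Proof. by rewrite /ell; have := len_gt0 e; case: (len e). Qed.

Let delta (x : vertex G -> R) e : R := (x (tgt e) - x (src e) + w e) / ell e.
Let integral x e : bool := delta x e \is a Num.int.

Let rise_rev x e : rise (@base R G) (@head R G) L W x (e, true) = - delta x e.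
Proof. by rewrite /rise /delta /L /W /base /head /= -mulNr; congr (_ / _); ring. Qed.

Let chip x v := chips (@base R G) (@head R G) L W b x v.

Let chipE x v : chip x v = coeff (inl v) D +
  \sum_(e | src e == v) Num.floor (delta x e) +
  \sum_(e | tgt e == v) (n e + Num.floor (- delta x e)).
Proof.
rewrite /chip /chips /b dart_sum big_split /=.
rewrite [X in _ + (_ + X)](eq_bigr (fun e => Num.floor (- delta x e))); last first.
  by move=> e _; rewrite rise_rev.
by rewrite -!addrA; congr (_ + _); rewrite addrCA.
Qed.

Let reduced : exists x : vertex G -> R, exists rho : vertex G -> nat,
  exists q, (forall e, len e = +oo%E -> tgt e != q) /\
  forall v, v != q -> 0 <= chip x v <
    \sum_(h : dart G | base h == v) ((rho (head h) < rho v)%N && integral x h.1 : nat)%:Z.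
Proof.
have [q qfin] := finite_vertex G.
have [|h|h|h|A qA AT|x [rho xP]] := @reduced_potential R _ (dart G)
   (@base R G) (@head R G) (@rev R G) L W b q.
- by move=> [e o]; rewrite /rev /= negbK.
- by rewrite /base /head /rev /=; case: h.2.
- exact: ell_gt0.
- by [].
- exact: cut_dart qA AT.
exists x, rho, q; split=> // v /xP/andP[-> ub] /=; apply: lt_le_trans ub _.
apply: ler_sum => -[e o] _; rewrite /chip_free; case: o; last by [].
by rewrite rise_rev rpredN.
Qed.

Let frac x e : R := delta x e - (Num.floor (delta x e))%:~R.

(** Position of the chip left inside an edge with non-integral [delta]: the slope
    increases by one at distance [ell e * frac x e] from the target.  The midpoint
    serves for the edges that need a peak without carrying a chip. *)
Let peak x e : R := if integral x e then ell e / 2 else ell e * (1 - frac x e).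
Let chip_inside x e : int := (~~ integral x e : nat)%:Z.

Let peak_interior x e r : len e = r%:E -> 0 < peak x e /\ ((peak x e)%:E < len e)%E.
Proof.
move=> le; have r0 : 0 < r by have := len_gt0 e; rewrite le.
rewrite /peak /frac /ell le lte_fin; case: ifPn => [_|nint]; first by split; lra.
have /andP[f1 f2] := floor_itv (delta x e).
have f3 : (Num.floor (delta x e))%:~R < delta x e.
  by rewrite lt_neqAle f1 andbT -intrEfloor.
split; first by rewrite pmulr_rgt0 //; rewrite intrD in f2; lra.
by rewrite gtr_pMr //; lra.
Qed.

(** The rational function with vertex values [x] and initial slopes
    [floor (delta x e)] moves [D] to a divisor with at most one chip per edge. *)
Let reduced_equiv x :
  (forall e, chip_inside x e != 0 -> 0 < peak x e /\ ((peak x e)%:E < len e)%E) ->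
  principal (ve_divisor (chip x) (chip_inside x) (peak x) - D).
Proof.
move=> chip_int.
apply: (@balanced_principal _ _ _ x (fun e => Num.floor (delta x e))); split=> [e r le|v].
  rewrite momentB (moment_ve _ chip_int le) /chip_inside.
  have dE : x (tgt e) - x (src e) + moment e r D = r * delta x e.
    rewrite /delta /w /ell le; have := len_gt0 e; rewrite le lte_fin => r0; field.
    by rewrite gt_eqF.
  rewrite /peak /frac /ell le; case: (boolP (integral x e)) => /= [xint|_].
    have := xint; rewrite /integral intrEfloor => /eqP flE.
    by rewrite mulr0z flE; lra.
  by rewrite mulr1z; lra.
rewrite coeffB coeff_ve // chipE -sumrN -!addrA (addrC (coeff _ _)) !addrA subrK.
congr (_ + _); apply: eq_bigr => e _; rewrite edge_degB edge_deg_ve // /chip_inside /n.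
have := ceil_floor (delta x e); rewrite ceilNfloor -/(integral x e).
set f1 := Num.floor (- _); set f2 := Num.floor _; set k := edge_deg _ _ _.
by move: f1 f2 k (~~ _) => f1 f2 k o; lia.
Qed.

(** If [|D|] is empty, its reduced form is in debt at the base vertex [q], and it is
    dominated by the orientation divisor of the burning order: a vertex burns
    through more chip-free edges than it has chips, and a peak is put on every
    edge with a chip and on every edge whose ends burn at the same time. *)
Theorem nonspecial_divisor : ~ (linear_system D !=set0) ->
  exists nu : divisor G, [/\ deg nu = genus G - 1, linear_system (nu - D) !=set0
    & ~ (linear_system (Defs.canonical G - nu) !=set0)].
Proof.
move=> noD; have [x [rho [q [qfin red]]]] := reduced.
pose peaked e := ~~ integral x e || (rho (src e) == rho (tgt e)).
(* the far end of an infinite edge has a single dart, so it must burn through it *)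
have infinite e : len e = +oo%E -> ~~ peaked e /\ (rho (src e) < rho (tgt e))%N.
  move=> le; have /andP[] := red _ (qfin e le).
  rewrite dart_sum chipE !sum_src_infinite // !sum_tgt_infinite // addr0 add0r.
  rewrite /head /peaked /=; case: (ltnP (rho _) _) => [lt_rho|_]; last by move=> *; lia.
  case: (boolP (integral x e)) => [_|_]; last by move=> *; lia.
  by rewrite ltn_eqF.
have peak_int e : peaked e -> 0 < peak x e /\ ((peak x e)%:E < len e)%E.
  move=> pe; have := len_gt0 e; case le : (len e) => [r||] // _.
    by rewrite -le; exact: peak_interior le.
  by have [] := infinite e le; rewrite pe.
have slanted e : ~~ peaked e -> rho (src e) != rho (tgt e).
  by rewrite negb_or => /andP[].
have chip_int e : chip_inside x e != 0 -> 0 < peak x e /\ ((peak x e)%:E < len e)%E.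
  by rewrite /chip_inside => ze; apply: peak_int; rewrite /peaked; case: integral ze.
have D'D := reduced_equiv chip_int.
have neg_q : chip x q < 0.
  rewrite ltNge; apply/negP => q0; apply: noD.
  exists (ve_divisor (chip x) (chip_inside x) (peak x)); split=> //.
  apply: effective_ve => // v; have [->//|/red/andP[]//] := eqVneq v q.
have dominated v : chip x v < descents rho peaked v.
  have desc0 u : 0 <= descents rho peaked u by apply: sumr_ge0.
  have [->|/red/andP[_ /lt_le_trans]] := eqVneq v q; first exact: lt_le_trans (desc0 q).
  apply; apply: ler_sum => h /eqP bh; rewrite /descending bh.
  rewrite /peaked negb_or negbK; case: (integral x h.1); rewrite ?andbF //= andbT.
  case: (ltnP (rho (head h))) => //; rewrite andbT => lt_rho.
  suff -> : rho (src h.1) != rho (tgt h.1) by [].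
  by move: lt_rho; rewrite -bh /base /head; case: ifP => _; rewrite neq_ltn => ->; rewrite ?orbT.
exists (orientation_divisor rho peaked (peak x)); split.
- exact: deg_orientation.
- exists (ve_divisor (fun v => descents rho peaked v - 1 - chip x v)
     (fun e => (peaked e : nat)%:Z - chip_inside x e) (peak x)); split.
    apply: effective_ve => [v|e]; first by have := dominated v; lia.
    by rewrite /chip_inside /peaked; case: integral => //=; case: eqP.
  by rewrite /lin_equiv -ve_divisorB opprB addrC addrA subrK -opprB; exact: principalN.
exact: canonical_sub_orientation.
Qed.

End Nonspecial.

(** * Rank, Riemann-Roch and Clifford *)

Section Rank.
Variables (R : realType) (G : tropical_curve R).
Implicit Types D E H : divisor G.

Local Notation K := (Defs.canonical G).
Local Notation inhabited_system D := (linear_system D !=set0).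

Lemma lin_equiv_refl D : lin_equiv D D.
Proof. by rewrite /lin_equiv subrr; exact: principal0. Qed.

Lemma lin_equiv_sym D E : lin_equiv D E -> lin_equiv E D.
Proof. by move=> /principalN; rewrite opprB. Qed.

Lemma lin_equiv_trans D E H : lin_equiv D E -> lin_equiv E H -> lin_equiv D H.
Proof. by move=> DE EH; have := principalD DE EH; rewrite addrA subrK. Qed.

Lemma lin_equivD D1 E1 D2 E2 : lin_equiv D1 E1 -> lin_equiv D2 E2 ->
  lin_equiv (D1 + D2) (E1 + E2).
Proof. by move=> DE1 DE2; have := principalD DE1 DE2; rewrite /lin_equiv opprD addrACA. Qed.

Lemma lin_equivN D E : lin_equiv D E -> lin_equiv (- D) (- E).
Proof. by move=> /principalN; rewrite /lin_equiv opprD. Qed.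

Lemma lin_equivB D1 E1 D2 E2 : lin_equiv D1 E1 -> lin_equiv D2 E2 ->
  lin_equiv (D1 - D2) (E1 - E2).
Proof. by move=> DE1 /lin_equivN; exact: lin_equivD. Qed.

Lemma lin_equivI D E H : lin_equiv (D + H) (E + H) -> lin_equiv D E.
Proof. by rewrite /lin_equiv opprD addrACA subrr addr0. Qed.

Lemma lin_equiv_deg D E : lin_equiv D E -> deg D = deg E.
Proof. by move/principal_deg/eqP; rewrite degB subr_eq0 => /eqP. Qed.

Lemma lin_equiv_inhabited D E : lin_equiv D E -> inhabited_system D -> inhabited_system E.
Proof. by move=> DE [H [H0 HD]]; exists H; split=> //; exact: lin_equiv_trans DE. Qed.

Lemma effectiveD D E : effective D -> effective E -> effective (D + E).
Proof. by move=> D0 E0 P; rewrite coeffD addr_ge0. Qed.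

Lemma effective_inhabited D : effective D -> inhabited_system D.
Proof. by exists D; split => //; exact: lin_equiv_refl. Qed.

Lemma inhabitedD D E : inhabited_system D -> inhabited_system E -> inhabited_system (D + E).
Proof.
move=> [D' [D'0 DD]] [E' [E'0 EE]]; exists (D' + E'); split; first exact: effectiveD.
exact: lin_equivD.
Qed.

Lemma effective_deg D : effective D -> 0 <= deg D.
Proof. by move=> D0; rewrite -total_deg total_ge0. Qed.

Lemma inhabited_deg D : inhabited_system D -> 0 <= deg D.
Proof. by move=> [H [H0 /lin_equiv_deg <-]]; exact: effective_deg. Qed.

Lemma effective_deg0 D : effective D -> deg D = 0 -> D = 0.
Proof. by move=> /fgposP; exact: fgpos_eq0P. Qed.

Lemma effective_of_deg (n : nat) : exists2 D : divisor G, effective D & deg D = n%:Z.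
Proof.
have /card_gt0P[v _] := vertex_inhabited G.
exists << n%:Z *g (inl v : curve_point G) >>; last exact: degU.
by move=> P; rewrite coeffU mulr_ge0.
Qed.

(** Used to test the rank of a sum of divisors on both summands. *)
Lemma effective_split (m n : nat) D : effective D -> deg D = (m + n)%N%:Z ->
  exists D1 D2, [/\ effective D1, effective D2, deg D1 = m%:Z, deg D2 = n%:Z & D = D1 + D2].
Proof.
elim: m n D => [|m IHm] n D D0 Dmn.
  exists 0, D; split; rewrite ?add0r ?deg0 // => P; by rewrite coeff0.
have [P P0] : exists P, 0 < coeff P D.
  apply: contrapT => noP; suff D_0 : D = 0 by move: Dmn; rewrite D_0 deg0.
  apply/eqP/freeg_eqP => P; rewrite coeff0; apply/le_anti; rewrite D0 andbT.
  by rewrite leNgt; apply/negP => P0; apply: noP; exists P.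
have [||D1 [D2 [D10 D20 d1 d2 DE]]] := IHm n (D - << P >>).
- move=> Q; rewrite coeffB coeffU mul1r; have := D0 Q.
  by case: eqVneq => [<-|_] /=; [move: P0; lia | rewrite subr0].
- by rewrite degB degU Dmn; lia.
exists (D1 + << P >>), D2; split=> //.
- by apply: effectiveD => // Q; rewrite coeffU mul1r.
- by rewrite degD d1 degU; lia.
- by rewrite addrAC -DE subrK.
Qed.

Lemma rank_set_equiv D E r : lin_equiv D E -> rank_set D r -> rank_set E r.
Proof.
move=> DE Dr H H0 Hr; apply: lin_equiv_inhabited (Dr H H0 Hr).
exact: lin_equivB DE (lin_equiv_refl H).
Qed.

Lemma rank_set_deg D r : rank_set D r -> r%:Z <= deg D.
Proof.
have [H H0 Hr] := effective_of_deg r.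
by move=> /(_ H H0 Hr) /inhabited_deg; rewrite degB Hr subr_ge0.
Qed.

Lemma rank_set_le D (m n : nat) : (m <= n)%N -> rank_set D n -> rank_set D m.
Proof.
move=> le_mn Dn H H0 Hm.
have [E E0 En] := effective_of_deg (n - m).
have := Dn (H + E) (effectiveD H0 E0); rewrite degD Hm En => /(_ _)[]; first by lia.
move=> F [F0 FD]; exists (F + E); split; first exact: effectiveD.
by have := lin_equivD FD (lin_equiv_refl E); rewrite opprD addrA subrK.
Qed.

Lemma rank_set0 D : rank_set D 0%N <-> inhabited_system D.
Proof.
split=> [/(_ 0)|DI E E0 Ed]; last by rewrite (effective_deg0 E0 Ed) subr0.
by rewrite subr0; apply=> [P|]; rewrite ?coeff0 ?deg0.
Qed.

(** For a divisor with nonempty linear system the set of candidates contains 0 and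
    is bounded by the degree, so its maximum exists. *)
Lemma rank_geP D (n : nat) : n%:Z <= rank D <-> rank_set D n.
Proof.
rewrite /rank; case: asboolP => [D0|/eqP/set0P DI].
  split=> // /(rank_set_le (leq0n n)) /rank_set0; rewrite D0 => -[E []].
pose M := rank_set D `&` ubound (rank_set D).
have [m Mm] : exists m, M m.
  have ex0 : exists n, `[< rank_set D n >] by exists 0%N; apply/asboolP/rank_set0.
  have bd k : `[< rank_set D k >] -> (k <= `|deg D|)%N.
    by move=> /asboolP /rank_set_deg; lia.
  case: (ex_maxnP ex0 bd) => m /asboolP Dm mmax; exists m; split=> // k Dk.
  by apply: mmax; apply/asboolP.
have [Dx xmax] := xgetPex 0%N (ex_intro _ m Mm).
split=> [le_n|/xmax //]; apply: rank_set_le Dx; move: le_n; by rewrite lez_nat.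
Qed.

Lemma rank_set_add D E m n : rank_set D m -> rank_set E n -> rank_set (D + E) (m + n)%N.
Proof.
move=> Dm En H H0 Hmn.
have [H1 [H2 [H10 H20 d1 d2 ->]]] := effective_split H0 Hmn.
by rewrite opprD addrACA; apply: inhabitedD; [apply: Dm | apply: En].
Qed.

Lemma rank_set_muln D m (k : nat) : rank_set D m -> rank_set (D *+ k) (m * k)%N.
Proof.
move=> Dm; elim: k => [|k IHk]; last by rewrite mulrS mulnS; exact: rank_set_add.
by rewrite mulr0n muln0; apply/rank_set0/effective_inhabited => P; rewrite coeff0.
Qed.

Lemma deg_canonical : deg K = (genus G - 1) * 2.
Proof.
rewrite (canonical_ve (fun=> 0)) deg_ve big1_eq addr0 sumrB.
under eq_bigr do rewrite valenceE.
rewrite sum_fibers !sumr_const card_prod card_bool /genus !natz -[2 *+ _]mulr_natr natz.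
by move: #|edge G| #|_| => m n; lia.
Qed.

(** Suppose [K - D - E] is not equivalent to an effective divisor, and let [nu] be
    a nonspecial divisor dominating it: [nu - (K - D - E) ~ H >= 0] with
    [deg H = r].  As [D] has rank [r], [D - H ~ F >= 0], and then
    [K - nu ~ F + E >= 0], which is excluded. *)
Theorem riemann_roch_ge D (r m : nat) : rank_set D r ->
  m%:Z = r%:Z - deg D + (genus G - 1) -> rank_set (K - D) m.
Proof.
move=> Dr mE E E0 Em; apply: contrapT => /nonspecial_divisor[nu [nu_deg [H [H0 Hnu]] noK]].
have [|F [F0 FD]] := Dr H H0.
  by rewrite (lin_equiv_deg Hnu) !degB nu_deg deg_canonical Em mE; lia.
apply: noK; exists (F + E); split; first exact: effectiveD.
have := lin_equivD (lin_equiv_trans FD (lin_equivB (lin_equiv_refl D) Hnu)) (lin_equiv_refl E).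
rewrite (_ : D - (nu - (K - D - E)) + E = K - nu) //.
by apply/eqP/freeg_eqP => P; rewrite !(coeffD, coeffN); ring.
Qed.

Lemma special_deg D : special D -> 0 <= deg D <= (genus G - 1) * 2.
Proof.
move=> [D0 /rank_geP/rank_set0/inhabited_deg]; rewrite degB deg_canonical => le_D.
by rewrite effective_deg //=; lia.
Qed.

(** With [m] the lower bound of Riemann-Roch for the rank of [K - D], [K] has rank
    at least [r + m].  If this exceeded [g - 1], Riemann-Roch for [K] would put
    effective divisors of degree [k > 0] into the zero class.  When [m] would be
    negative the degree of [D] is so large that the claim is immediate. *)
Theorem clifford D (r : nat) : special D -> rank_set D r -> r%:Z * 2 <= deg D.
Proof.
move=> spD Dr; have /andP[d0 dK] := special_deg spD.
have [|m0] := ltrP (r%:Z - deg D + (genus G - 1)) 0; first by lia.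
pose m := absz (r%:Z - deg D + (genus G - 1)).
have mE : m%:Z = r%:Z - deg D + (genus G - 1) by rewrite gez0_abs.
have := rank_set_add Dr (riemann_roch_ge Dr mE); rewrite addrC subrK => Krm.
have [|lt_g] := lerP (r + m)%N%:Z (genus G - 1); first by rewrite PoszD mE; lia.
pose k := absz ((r + m)%N%:Z - (genus G - 1))%R.
have kE : k%:Z = (r + m)%N%:Z - deg K + (genus G - 1) by rewrite deg_canonical /k; lia.
have /rank_set_deg := riemann_roch_ge Krm kE; rewrite subrr deg0 /k; lia.
Qed.

(** By Riemann-Roch [K - D] is equivalent to an effective divisor, of degree 0. *)
Lemma canonical_unique D (g : nat) : genus G = g.+1 -> rank_set D g ->
  deg D = g%:Z * 2 -> lin_equiv D K.
Proof.
move=> gE Dg Dd; have [|H [H0 HKD]] := (rank_set0 (K - D)).1 (@riemann_roch_ge D g 0 Dg _).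
  by rewrite gE; lia.
have H_0 : H = 0.
  by apply: effective_deg0 => //; rewrite (lin_equiv_deg HKD) degB deg_canonical gE; lia.
by move: HKD; rewrite H_0 /lin_equiv sub0r opprB.
Qed.

(** Both [D] and [r E] become canonical after adding [(g - r) E], where the genus is
    [g.+1]. *)
Lemma clifford_eq D E (r : nat) : special D -> rank_set E 1%N -> deg E = 2 ->
  rank_set D r -> deg D = r%:Z * 2 -> lin_equiv D (E *+ r).
Proof.
move=> spD E1 Ed Dr Dd; have /andP[_ dK] := special_deg spD.
have [g [gE le_rg]] : exists g : nat, genus G = g.+1 /\ (r <= g)%N.
  by exists (absz (genus G - 1)%R); split; lia.
have Ek k : rank_set (E *+ k) k by have := @rank_set_muln _ _ k E1; rewrite mul1n.
have DK : lin_equiv (D + E *+ (g - r)) K.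
  apply: (canonical_unique gE); first by have := rank_set_add Dr (Ek (g - r)%N); rewrite subnKC.
  by rewrite degD degMn Dd Ed; lia.
have EK : lin_equiv (E *+ r + E *+ (g - r)) K.
  rewrite -mulrnDr subnKC //; apply: (canonical_unique gE) => //.
  by rewrite degMn Ed; lia.
exact: lin_equivI (lin_equiv_trans DK (lin_equiv_sym EK)).
Qed.

End Rank.

Theorem theorem1 (R : realType) (G : tropical_curve R) (g : nat)
  (genusG : genus G = g%:Z) (D : divisor G) (specialD : special D) :
  (rank D)%:Q <= (deg D)%:Q / 2 /\
  (hyperelliptic G -> forall E : divisor G, is_g12 E ->
     ((rank D)%:Q = (deg D)%:Q / 2 <-> exists r : nat, lin_equiv D (E *+ r)) /\
     (forall r : nat,
        lin_equiv D (E *+ r) <-> linear_system D = linear_system (E *+ r))).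
Proof.
have D0 := specialD.1.
have [r rE] : exists r : nat, rank D = r%:Z.
  have := (rank_geP D 0).2; rewrite rank_set0 => /(_ (effective_inhabited D0)).
  by case: (rank D) => // r _; exists r.
have Dr : rank_set D r by apply/rank_geP; rewrite rE.
have cliff := clifford specialD Dr.
have halfE (a b : int) : (a%:Q = b%:Q / 2) <-> a * 2 = b.
  split=> [ab|<-]; last by rewrite intrM mulfK.
  by apply: (@intr_inj rat); rewrite intrM ab divfK.
split; first by rewrite rE ler_pdivlMr // -(intrM _ _ 2) ler_int.
move=> _ E [Ed rankE].
have E1 : rank_set E 1%N by apply/rank_geP; rewrite rankE.
split=> [|s]; last first.
  split=> [DE|eqDE].
    apply/seteqP; split=> H [H0 HD]; split=> //; first exact: lin_equiv_trans DE.
    exact: lin_equiv_trans HD (lin_equiv_sym DE).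
  have : linear_system D D by split=> //; exact: lin_equiv_refl.
  by rewrite eqDE => -[].
rewrite rE; split=> [/halfE rD|[s DE]].
  by exists r; apply: clifford_eq => //; rewrite rD.
apply/halfE.
have degD : deg D = s%:Z * 2 by rewrite (lin_equiv_deg DE) degMn Ed; lia.
have Ds : rank_set D s.
  apply: rank_set_equiv (lin_equiv_sym DE) _.
  by have := @rank_set_muln _ _ _ _ s E1; rewrite mul1n.
have := (rank_geP D s).2 Ds; rewrite rE; lia.
Qed.
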